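(* Let $p,N\ge 1$, let $Y_1,\dots,Y_N\in\mathbb{R}^p$ and $W_1,\dots,W_N\in\mathbb{R}_{>0}$, and let $Y^{W}=\left(\frac{1}{\sqrt{W_1}}Y_1,\dots,\frac{1}{\sqrt{W_N}}Y_N\right)\in\mathbb{R}^{pN}$. Let $G\subseteq GL(\mathbb{R}^p)$ be a Zariski closed self-adjoint group which is closed under non-zero scalar multiples, and let $G_{SL}^{+}$ be the subgroup of matrices in $G$ of determinant $1$. The stability of $Y^W$ under the action of $G_{SL}^{+}$ on $\mathbb{R}^{pN}$ is related to maximum likelihood estimation over $\mathcal{L}_G$ as follows: (a) $Y^{W}$ is unstable $\iff$ $\ell_c(\Psi)$ is not bounded from above on $\mathcal{L}_G$; (b) $Y^{W}$ is semistable $\iff$ $\ell_c(\Psi)$ is bounded from above on $\mathcal{L}_G$; (c) $Y^{W}$ is polystable $\iff$ an MLE exists; (d) $Y^{W}$ is stable $\implies$ finitely many MLEs exist (i.e. the set of MLEs is non-empty and finite) $\iff$ a unique MLE exists.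
   Context: $(Y_1,\dots,Y_N,W_1,\dots,W_N)$ is a (realized) sample from the joint distribution of $(Y,W)$, where $Y=\sqrt{W}Z$, $W\sim \mathrm{Exp}(1)$ and $Z\sim\mathcal{N}_p(0,\Sigma)$ are independent; thus $Y$ has the multivariate symmetric Laplace distribution with positive definite scale matrix $\Sigma$. The concentration matrix is $\Psi=\Sigma^{-1}$. The Laplace group model defined by $G$ is $\mathcal{L}_G=\{A^\top A\mid A\in G\}$. The complete-data log-likelihood function (up to an additive constant and a positive factor) is $$\ell_c(\Psi)=N\log|\Psi|-\sum_{i=1}^N\frac{1}{W_i}\operatorname{tr}(\Psi Y_iY_i^\top),$$ where $|\cdot|$ is the determinant. An MLE is a matrix $\hat\Psi\in\mathcal{L}_G$ maximizing $\ell_c$ over $\mathcal{L}_G$. A matrix $A$ acts on $\mathbb{R}^{pN}$ diagonally: $A\cdot Y^W=\left(\frac{1}{\sqrt{W_1}}AY_1,\dots,\frac{1}{\sqrt{W_N}}AY_N\right)$. A subgroup $G\subseteq GL(\mathbb{R}^p)$ is Zariski closed if it is the zero locus (in $GL(\mathbb{R}^p)$) of a set of polynomials in the matrix entries; it is self-adjoint if $g\in G$ implies $g^\top\in G$. Stability: for a group $H$ acting linearly on a real vector space with Euclidean norm, a vector $v$ is (1) unstable if $0\in\overline{H\cdot v}$, i.e. $\inf_{h\in H}\|h\cdot v\|^2=0$; (2) semistable if $0\notin\overline{H\cdot v}$, i.e. $\inf_{h\in H}\|h\cdot v\|^2>0$; (3) polystable if $v\ne0$ and the orbit $H\cdot v$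 is closed; (4) stable if $v$ is polystable and its stabilizer $H_v=\{h\in H\mid h\cdot v=v\}$ is finite. Closures are in the Euclidean topology. Here $H=G_{SL}^{+}$. *)

(* Defs.v *)
From mathcomp Require Import all_boot all_order all_algebra.
From mathcomp Require Import all_classical all_reals all_analysis.
(* Not imported: the notations of mpoly clash with those of analysis. *)
From mathcomp Require multinomials.mpoly.

Set Implicit Arguments.
Unset Strict Implicit.
Unset Printing Implicit Defensive.

Import Order.TTheory GRing.Theory Num.Theory.
Import numFieldNormedType.Exports.

Local Open Scope classical_set_scope.
Local Open Scope ring_scope.

(* A group acting on V is given by its underlying set H and the action act.
   The topology of V is the one of its norm; in finite dimension all norms
   induce the Euclidean topology. *)
Section Stability.
Context (R : realType) (T : Type) (V : normedModType R).
Implicit Types (act : T -> V -> V) (H : set T) (v : V).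

Definition orbit_set act H v : set V := [set act h v | h in H].

Definition stabilizer act H v : set T := [set h | H h /\ act h v = v].

Definition unstable act H v : Prop := closure (orbit_set act H v) 0.

Definition semistable act H v : Prop := ~ closure (orbit_set act H v) 0.

Definition polystable act H v : Prop := v <> 0 /\ closed (orbit_set act H v).

Definition stable act H v : Prop :=
  polystable act H v /\ finite_set (stabilizer act H v).

End Stability.

Section MatrixGroups.
Context (R : realType) (p : nat).
Implicit Types G : set 'M[R]_p.

Definition is_subgroup_GL G : Prop :=
  [/\ G `<=` [set A | A \in unitmx],
      G 1%:M,
      (forall A B, G A -> G B -> G (A *m B)) &
      (forall A, G A -> G (invmx A))].

(* The p * p polynomial variables are the matrix entries, enumerated as in
   mxvec. *)
Definition poly_eval (f : mpoly.mpoly (p * p) R) (A : 'M[R]_p) : R :=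
  mpoly.meval (fun k => mxvec A 0 k) f.

Definition zariski_closed G : Prop :=
  exists F : set (mpoly.mpoly (p * p) R),
    G = [set A | A \in unitmx /\ forall f, F f -> poly_eval f A = 0].

Definition self_adjoint G : Prop := forall A, G A -> G A^T.

Definition closed_under_scaling G : Prop :=
  forall (c : R) A, c != 0 -> G A -> G (c *: A).

Definition SL_plus G : set 'M[R]_p := [set A | G A /\ \det A = 1].

End MatrixGroups.

Section LaplaceGroupModel.
Context (R : realType) (p N : nat).
Implicit Types (Y : 'I_N -> 'cV[R]_p) (W : 'I_N -> R) (G : set 'M[R]_p).

(* R^(pN) is represented by 'M[R]_(p, N): column i is the i-th vector of R^p.
   The product A *m v applies A to every column of v. *)
Definition diag_act (A : 'M[R]_p) (v : 'M[R]_(p, N)) : 'M[R]_(p, N) := A *m v.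

Definition scaled_sample Y W : 'M[R]_(p, N) :=
  \matrix_(j, i) ((Num.sqrt (W i))^-1 *: Y i) j 0.

Definition laplace_model G : set 'M[R]_p := [set A^T *m A | A in G].

Definition loglik Y W (Psi : 'M[R]_p) : R :=
  N%:R * ln (\det Psi)
  - \sum_(i < N) (W i)^-1 * \tr (Psi *m (Y i *m (Y i)^T)).

Definition loglik_bounded Y W G : Prop :=
  has_ubound [set loglik Y W Psi | Psi in laplace_model G].

Definition is_MLE Y W G (Psi : 'M[R]_p) : Prop :=
  laplace_model G Psi /\
  forall Psi', laplace_model G Psi' -> loglik Y W Psi' <= loglik Y W Psi.

End LaplaceGroupModel.

(* Main.v *)
Require Import Defs.
From mathcomp Require Import all_boot all_order all_algebra.
From mathcomp Require Import ring lra.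
From mathcomp Require multinomials.mpoly.
From mathcomp Require Import all_classical all_reals all_analysis.

Import Order.TTheory GRing.Theory Num.Theory.
Import numFieldNormedType.Exports.

Set Implicit Arguments.
Unset Strict Implicit.
Unset Printing Implicit Defensive.

Local Open Scope classical_set_scope.
Local Open Scope ring_scope.

(** Write [v] for the scaled sample and [q h] for the squared Frobenius norm of
    [h *m v]. Every element of the model is [x *: (h^T *m h)] with [0 < x] and
    [h] in [G] of determinant [1] or [-1], and its log-likelihood is
    [N p ln x - x q(h)]. For fixed [h] this is largest at [x = N p / q(h)], and
    the largest value is a decreasing function of [q h]. So the likelihood is
    bounded if and only if [q] is bounded away from [0] ([loglik_boundedP]), and
    its maximizers are the [(N p / q(h)) *: (h^T *m h)] with [h v] nonzero and
    of minimal norm in its orbit ([is_MLEP]). Elements of determinant [-1] do no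
    harm: the subgroup of determinant [1] has index at most two.

    It remains to relate minimal vectors to closed orbits and to uniqueness,
    which is the theorem of Kempf and Ness for real self-adjoint groups. For [g]
    in [G] the matrix [g^T *m g] is positive definite. An equation of [G],
    evaluated at its real powers, is an exponential polynomial which vanishes at
    the integers, hence everywhere: all real powers of [g^T *m g] lie in [G]
    ([zariski_spow]). Along such a one-parameter group the squared norm of a
    vector is a sum of exponentials, a convex function of the time; if it is
    minimal at two different times, then the vector is fixed by the whole group
    ([spow_fix_of_min]).

    A closed orbit has a vector of minimal norm by compactness. Conversely let
    [w] be minimal. A group element can be replaced by the shortest element of
    its coset modulo the stabilizer of [w]; the shortest elements [h] with [h w]
    in a given ball are bounded ([shortest_bounded]), so a limit of points of
    the orbit lifts to a limit in the group and the orbit is closed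
    ([closed_orbit_of_min]). They are bounded because the directions of an
    unbounded family would accumulate at a one-parameter group which, by
    convexity, fixes [w], and moving back along that group would shorten [h].

    Two maximizers come from two minimal vectors of one orbit, so a
    one-parameter group fixing the minimal vector joins them ([MLE_not_unique]).
    If they differ, that group is an infinite family of elements of the
    stabilizer and produces infinitely many maximizers; this gives both the
    implication from stability and the equivalence of finiteness with
    uniqueness. *)

(** * The Frobenius norm *)

Definition fnorm2 (R : realType) m n (A : 'M[R]_(m, n)) : R := \tr (A^T *m A).

Section FrobeniusNorm.
Context (R : realType).

Lemma fnorm2E m n (A : 'M[R]_(m, n)) :
  fnorm2 A = \sum_j \sum_i A i j ^+ 2.
Proof.
rewrite /fnorm2 /mxtrace; apply: eq_bigr => j _; rewrite mxE.
by apply: eq_bigr => i _; rewrite mxE expr2.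
Qed.

Lemma fnorm2_ge0 m n (A : 'M[R]_(m, n)) : 0 <= fnorm2 A.
Proof.
by rewrite fnorm2E; do 2!apply: sumr_ge0 => ? _; rewrite sqr_ge0.
Qed.

Lemma sqr_entry_le_fnorm2 m n (A : 'M[R]_(m, n)) i j : A i j ^+ 2 <= fnorm2 A.
Proof.
rewrite fnorm2E (bigD1 j) //= (bigD1 i) //= -addrA lerDl.
by apply: addr_ge0; repeat (apply: sumr_ge0 => ? _); rewrite sqr_ge0.
Qed.

Lemma fnorm2_eq0 m n (A : 'M[R]_(m, n)) : (fnorm2 A == 0) = (A == 0).
Proof.
apply/eqP/eqP => [A0|->]; last first.
  by rewrite fnorm2E; do 2!apply: big1 => ? _; rewrite mxE expr0n.
apply/matrixP => i j; rewrite mxE; apply/eqP.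
by rewrite -sqrf_eq0 eq_le sqr_ge0 -A0 sqr_entry_le_fnorm2.
Qed.

Lemma fnorm2_gt0 m n (A : 'M[R]_(m, n)) : (0 < fnorm2 A) = (A != 0).
Proof. by rewrite lt_neqAle fnorm2_ge0 andbT eq_sym fnorm2_eq0. Qed.

Lemma fnorm2_orthl m n (O : 'M[R]_m) (A : 'M[R]_(m, n)) :
  O^T *m O = 1%:M -> fnorm2 (O *m A) = fnorm2 A.
Proof.
by move=> OO; rewrite /fnorm2 trmx_mul mulmxA -(mulmxA A^T) OO mulmx1.
Qed.

Lemma fnorm2Z m n c (A : 'M[R]_(m, n)) : fnorm2 (c *: A) = c ^+ 2 * fnorm2 A.
Proof.
rewrite !fnorm2E mulr_sumr; apply: eq_bigr => j _; rewrite mulr_sumr.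
by apply: eq_bigr => i _; rewrite mxE exprMn.
Qed.

(** Lagrange's identity: the difference of the two sides is half of the double
    sum of the squares [(a i * b j - a j * b i) ^+ 2]. *)
Lemma sum_mul_sqr_le (I : finType) (a b : I -> R) :
  (\sum_i a i * b i) ^+ 2 <= (\sum_i a i ^+ 2) * (\sum_i b i ^+ 2).
Proof.
have : 0 <= \sum_i \sum_j (a i * b j - a j * b i) ^+ 2.
  by do 2!apply: sumr_ge0 => ? _; rewrite sqr_ge0.
have -> : \sum_i \sum_j (a i * b j - a j * b i) ^+ 2 =
    2 * ((\sum_i a i ^+ 2) * (\sum_i b i ^+ 2)) -
    2 * (\sum_i a i * b i) ^+ 2.
  under eq_bigr do under eq_bigr do rewrite sqrrB.
  under eq_bigr do rewrite big_split sumrB /=.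
  rewrite big_split sumrB /= -mulrBr.
  rewrite [X in _ + X](_ : _ = \sum_i \sum_j a i ^+ 2 * b j ^+ 2); last first.
    rewrite exchange_big; apply: eq_bigr => i _; apply: eq_bigr => j _.
    by rewrite exprMn.
  rewrite [X in X - _](_ : _ = \sum_i \sum_j a i ^+ 2 * b j ^+ 2); last first.
    by apply: eq_bigr => i _; apply: eq_bigr => j _; rewrite exprMn.
  rewrite [X in _ - X](_ : _ = 2 * \sum_i \sum_j (a i * b i) * (a j * b j));
    last first.
    rewrite mulr_sumr; apply: eq_bigr => i _; rewrite mulr_sumr.
    apply: eq_bigr => j _.
    by rewrite -mulr_natl mulrACA [b j * _]mulrC mulrACA.
  by rewrite -!big_distrlr /= expr2; ring.
by rewrite -mulrBr pmulr_rge0 // subr_ge0.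
Qed.

Lemma fnorm2_mul_le m n k (A : 'M[R]_(m, n)) (B : 'M[R]_(n, k)) :
  fnorm2 (A *m B) <= fnorm2 A * fnorm2 B.
Proof.
have sE : fnorm2 A * fnorm2 B =
    \sum_j \sum_i (\sum_l A i l ^+ 2) * (\sum_l B l j ^+ 2).
  rewrite [fnorm2 A]fnorm2E exchange_big /= fnorm2E mulrC big_distrlr /=.
  by apply: eq_bigr => j _; apply: eq_bigr => i _; rewrite mulrC.
rewrite sE fnorm2E; apply: ler_sum => j _; apply: ler_sum => i _.
by rewrite mxE; exact: sum_mul_sqr_le.
Qed.

End FrobeniusNorm.

(** * Limits and compactness for matrices *)

Section MatrixTopology.
Context (R : realType).

Lemma cvg_mx T (F : set_system T) {FF : Filter F} m n
    (f : T -> 'M[R]_(m, n)) (L : 'M[R]_(m, n)) :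
  (forall i j, f x i j @[x --> F] --> L i j) -> f x @[x --> F] --> L.
Proof.
move=> fL; apply/cvg_ballP => e e0.
have : \near F, forall ij : 'I_m * 'I_n, ball (L ij.1 ij.2) e (f F ij.1 ij.2).
  apply: (@filter_forall T (('I_m * 'I_n)%type)
    (fun ij x => ball (L ij.1 ij.2) e (f x ij.1 ij.2)) F) => ij.
  exact: (@cvg_ball _ R).
by apply: filterS => x fx; split => // i j; exact: (fx (i, j)).
Qed.

Lemma cvg_entry T (F : set_system T) {FF : Filter F} m n
    (f : T -> 'M[R]_(m, n)) (L : 'M[R]_(m, n)) i j :
  f x @[x --> F] --> L -> f x i j @[x --> F] --> L i j.
Proof.
move=> fL; have := @coord_continuous R m n i j L.
exact: (cvg_comp f (fun M : 'M[R]_(m, n) => M i j) fL).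
Qed.

Lemma cvg_sumr T (F : set_system T) {FF : Filter F} (I : Type) (r : seq I)
    (P : pred I) (f : I -> T -> R) (l : I -> R) :
  (forall i, P i -> f i x @[x --> F] --> l i) ->
  \sum_(i <- r | P i) f i x @[x --> F] --> \sum_(i <- r | P i) l i.
Proof. by move=> ?; apply: cvg_big => //; exact: add_continuous. Qed.

Lemma cvg_prodr T (F : set_system T) {FF : Filter F} (I : Type) (r : seq I)
    (P : pred I) (f : I -> T -> R) (l : I -> R) :
  (forall i, P i -> f i x @[x --> F] --> l i) ->
  \prod_(i <- r | P i) f i x @[x --> F] --> \prod_(i <- r | P i) l i.
Proof. by move=> ?; apply: cvg_big => //; exact: mul_continuous. Qed.

Section Cvg.
Context (T : Type) (F : set_system T) {FF : Filter F}.

Lemma cvg_mulmx m n k (f : T -> 'M[R]_(m, n)) (g : T -> 'M[R]_(n, k))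
    (A : 'M[R]_(m, n)) (B : 'M[R]_(n, k)) :
  f x @[x --> F] --> A -> g x @[x --> F] --> B ->
  f x *m g x @[x --> F] --> A *m B.
Proof.
move=> fA gB; apply: cvg_mx => i j; rewrite mxE.
under eq_cvg do rewrite mxE.
by apply: cvg_sumr => l _; apply: cvgM; exact: cvg_entry.
Qed.

Lemma cvg_trmx m n (f : T -> 'M[R]_(m, n)) (A : 'M[R]_(m, n)) :
  f x @[x --> F] --> A -> (f x)^T @[x --> F] --> A^T.
Proof.
move=> fA; apply: cvg_mx => i j; rewrite mxE.
by under eq_cvg do rewrite mxE; exact: cvg_entry.
Qed.

Lemma cvg_mxtrace n (f : T -> 'M[R]_n) (A : 'M[R]_n) :
  f x @[x --> F] --> A -> \tr (f x) @[x --> F] --> \tr A.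
Proof. by move=> fA; apply: cvg_sumr => l _; exact: cvg_entry. Qed.

Lemma cvg_fnorm2 m n (f : T -> 'M[R]_(m, n)) (A : 'M[R]_(m, n)) :
  f x @[x --> F] --> A -> fnorm2 (f x) @[x --> F] --> fnorm2 A.
Proof.
by move=> fA; apply: cvg_mxtrace; apply: cvg_mulmx => //; exact: cvg_trmx.
Qed.

Lemma cvg_det n (f : T -> 'M[R]_n) (A : 'M[R]_n) :
  f x @[x --> F] --> A -> \det (f x) @[x --> F] --> \det A.
Proof.
move=> fA; apply: cvg_sumr => s _; apply: cvgM; first exact: cvg_cst.
by apply: cvg_prodr => i _; exact: cvg_entry.
Qed.

End Cvg.

Lemma ultra_fmap T U (f : T -> U) (F : set_system T) :
  UltraFilter F -> UltraFilter (f x @[x --> F]).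
Proof.
move=> FU; have FP := @ultra_proper _ _ FU.
split; first exact: fmap_proper_filter.
move=> G GP FG; apply/seteqP; split => // A GA.
have [//|FnA] := in_ultra_setVsetC (f @^-1` A) FU.
have : G (A `&` ~` A) by apply: filterI => //; exact: FG.
by rewrite setICr => /filter_not_empty.
Qed.

(** Sequential compactness of closed balls, with ultrafilters in the role of
    extracted subsequences. *)
Lemma ultra_bounded_cvg T (F : set_system T) m n (f : T -> 'M[R]_(m, n)) c :
  UltraFilter F -> F [set x | fnorm2 (f x) <= c] ->
  exists L : 'M[R]_(m, n), f x @[x --> F] --> L.
Proof.
move=> FU fc; have FP := @ultra_proper _ _ FU.
have lim i j : {l : R | f x i j @[x --> F] --> l}.
  apply: cid; have := @segment_compact R (- (1 + c)) (1 + c).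
  rewrite compact_ultra => /(_ _ (ultra_fmap (fun x => f x i j) FU)) [].
    rewrite /fmap /nbhs /=; apply: filterS fc => x fc /=.
    have := le_trans (sqr_entry_le_fnorm2 (f x) i j) fc.
    rewrite in_itv /= -ler_norml -[(f x i j) ^+ 2]real_normK ?num_real //.
    move=> le; rewrite leNgt; apply/negP => lt.
    have c0 : 0 <= c by apply: le_trans le; rewrite sqr_ge0.
    have : c < `|f x i j| ^+ 2; last by rewrite ltNge le.
    apply: (@lt_le_trans _ _ ((1 + c) ^+ 2)).
      rewrite sqrrD expr1n mul1r -mulr_natl.
      rewrite (@lt_le_trans _ _ (1 + 2 * c)) //.
        by rewrite mulr_natl mulr2n addrA ltr_pwDl // ltr_pwDl.
      by rewrite lerDl sqr_ge0.
    by rewrite lerXn2r ?nnegrE ?addr_ge0 // ltW.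
  by move=> l [_ fl]; exists l.
exists (\matrix_(i, j) sval (lim i j)); apply: cvg_mx => i j.
by rewrite mxE; apply: (svalP (lim i j)).
Qed.

Lemma closed_bounded_mx_compact m n (A : set 'M[R]_(m, n)) c :
  closed A -> (forall M, A M -> fnorm2 M <= c) -> compact A.
Proof.
move=> Acl Ac; rewrite compact_ultra => F FU FA.
have FP := @ultra_proper _ _ FU.
have [|L FL] := @ultra_bounded_cvg _ F m n (fun M => M) c FU.
  by apply: filterS FA => M /Ac.
by exists L; split => //; exact: (@closed_cvg _ _ F _ id A Acl FA L FL).
Qed.

Lemma closed_fnorm2_min m n (A : set 'M[R]_(m, n)) :
  closed A -> A !=set0 ->
  exists2 M, A M & forall M', A M' -> fnorm2 M <= fnorm2 M'.
Proof.
move=> Acl [a Aa].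
have cont : continuous (@fnorm2 R m n) 
  by move=> M; apply: (@cvg_fnorm2 _ (nbhs M) _ _ _ id M); exact: cvg_id.
pose B := A `&` [set M | fnorm2 M <= fnorm2 a].
have Bcl : closed B.
  apply: closedI => //; apply: (@closed_comp _ _ _ [set x | x <= fnorm2 a]).
    by move=> M _; exact: cont.
  exact: closed_le.
have Bco : compact B.
  by apply: (@closed_bounded_mx_compact _ _ _ (fnorm2 a)) => // M [].
have [||M] := compact_EVT_min _ Bco (f := @fnorm2 R m n).
- by exists a; split => /=.
- exact: continuous_subspaceT.
rewrite inE => -[AM Ma] Mmin; exists M => // M' AM'.
have [le|lt] := leP (fnorm2 M') (fnorm2 a); last exact: le_trans (ltW lt).
by apply: Mmin; rewrite inE.
Qed.

End MatrixTopology.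

(** * The real spectral theorem *)

Section SpectralTheorem.
Context (R : realType).

Definition orthogmx n (U : 'M[R]_n) := U^T *m U = 1%:M.

Lemma orthogmxC n (U : 'M[R]_n) : orthogmx U -> U *m U^T = 1%:M.
Proof. exact: mulmx1C. Qed.

Lemma orthogmxM n (U P : 'M[R]_n) :
  orthogmx U -> orthogmx P -> orthogmx (U *m P).
Proof.
by move=> oU oP; rewrite /orthogmx trmx_mul mulmxA -(mulmxA P^T) oU mulmx1.
Qed.

(** Rayleigh's principle. Let [v] minimize [q v = tr (v^T S v)] on the unit
    sphere, with minimum [l]. The form of [B = S - l] is then nonnegative and
    vanishes at [v], so its first variation at [v] vanishes as well, and in the
    direction [B v] that variation is twice the squared norm of [B v]. *)
Lemma symmetric_eigenvector n (S : 'M[R]_n.+1) : S^T = S ->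
  exists v : 'cV[R]_n.+1, exists l : R, fnorm2 v = 1 /\ S *m v = l *: v.
Proof.
move=> St.
pose q (v : 'cV[R]_n.+1) : R := \tr (v^T *m (S *m v)).
have qc : continuous q.
  move=> v; apply: (@cvg_mxtrace _ _ (nbhs v)); apply: cvg_mulmx.
    by apply: cvg_trmx; exact: cvg_id.
  by apply: cvg_mulmx; [exact: cvg_cst|exact: cvg_id].
pose A := [set v : 'cV[R]_n.+1 | fnorm2 v = 1].
have Ac : compact A.
  apply: (@closed_bounded_mx_compact _ _ _ _ 1); last by move=> v ->.
  rewrite /A; apply: (@closed_comp _ _ (@fnorm2 R _ _) [set x : R | x = 1]);
    last exact: closed_eq.
  by move=> v _; apply: (@cvg_fnorm2 _ _ (nbhs v) _ _ _ id v); exact: cvg_id.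
have [||v] := compact_EVT_min _ Ac (f := q).
- exists (delta_mx 0 0); rewrite /A /= /fnorm2 trmx_delta mul_delta_mx.
  rewrite /mxtrace (bigD1 0) //= big1 ?mxE ?eqxx ?addr0 // => i i0.
  by rewrite mxE (negPf i0).
- exact: continuous_subspaceT.
rewrite inE => v1 vmin; exists v, (q v); split => //.
set l := q v.
pose B := S - l%:M.
pose b (x y : 'cV[R]_n.+1) : R := \tr (x^T *m (B *m y)).
have bE x : b x x = q x - l * fnorm2 x.
  rewrite /b /B mulmxBl mulmxBr linearB /= mul_scalar_mx -scalemxAr.
  by rewrite mxtraceZ.
have bC x y : b x y = b y x.
  have Bt : B^T = B by rewrite /B linearB /= St tr_scalar_mx.
  by rewrite /b -[LHS]mxtrace_tr !trmx_mul trmxK Bt mulmxA.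
have b_ge0 x : 0 <= b x x.
  rewrite bE subr_ge0; have [->|x0] := eqVneq x 0.
    by rewrite /q !mulmx0 linear0 /fnorm2 mulmx0 linear0 mulr0.
  have f0 : 0 < fnorm2 x by rewrite fnorm2_gt0.
  set s := Num.sqrt (fnorm2 x).
  have s2 : s ^+ 2 = fnorm2 x by rewrite sqr_sqrtr // ltW.
  have s0 : 0 < s by rewrite sqrtr_gt0.
  have : l <= q (s^-1 *: x).
    apply: vmin; rewrite inE /A /= fnorm2Z exprVn s2 mulVf //.
    by rewrite gt_eqF.
  rewrite /q linearZ /= -scalemxAr -scalemxAr -scalemxAl !mxtraceZ mulrA.
  rewrite -expr2 exprVn s2 ler_pdivlMl //.
  by rewrite mulrC.
have bvv : b v v = 0 by rewrite bE v1 mulr1 subrr.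
set u := B *m v.
have : fnorm2 u = 0.
  have buv : b u v = fnorm2 u by [].
  have key t : 0 <= 2 * t * fnorm2 u + t ^+ 2 * b u u.
    have := b_ge0 (v + t *: u).
    have -> : b (v + t *: u) (v + t *: u) =
        b v v + t * b u v + t * b v u + t ^+ 2 * b u u.
      rewrite /b linearD linearZ /= mulmxDr -scalemxAr mulmxDl !mulmxDr.
      rewrite -!scalemxAl -!scalemxAr !mxtraceD !mxtraceZ.
      ring.
    rewrite bvv (bC v u) buv; congr (_ <= _); ring.
  have c0 := b_ge0 u; have f0 := fnorm2_ge0 u.
  set c := b u u in key c0; set f := fnorm2 u in key f0 *.
  have c1 : 0 < c + 1 by lra.
  (* [- f / c] would be the minimum; the shift avoids a vanishing [c]. *)
  have := key (- f / (c + 1)).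
  have -> : 2 * (- f / (c + 1)) * f + (- f / (c + 1)) ^+ 2 * c =
     - ((c + 2) * f ^+ 2 / (c + 1) ^+ 2) by field; rewrite gt_eqF.
  rewrite oppr_ge0 => le.
  have : (c + 2) * f ^+ 2 <= 0.
    by move: le; rewrite pmulr_lle0 // invr_gt0 exprn_gt0.
  rewrite pmulr_rle0; last lra.
  by move=> f2; apply/eqP; rewrite -sqrf_eq0 eq_le f2 sqr_ge0.
move/eqP; rewrite fnorm2_eq0 /u /B mulmxBl subr_eq0 => /eqP ->.
by rewrite mul_scalar_mx.
Qed.

(** The Householder reflection exchanging [v] with the first basis vector. *)
Lemma orthogmx_first_col n (v : 'cV[R]_n.+1) : fnorm2 v = 1 ->
  exists2 U : 'M[R]_n.+1, orthogmx U & U *m delta_mx 0 0 = v.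
Proof.
move=> v1; pose e : 'cV[R]_n.+1 := delta_mx 0 0.
have [->|ve] := eqVneq v e.
  by exists 1%:M; rewrite /orthogmx ?trmx1 mul1mx.
pose u := v - e.
have f0 : fnorm2 u != 0 by rewrite fnorm2_eq0 subr_eq0.
have uu : u^T *m u = (fnorm2 u)%:M.
  by rewrite [LHS]mx11_scalar /fnorm2 trace_mx11.
have e1 : e^T *m e = 1%:M.
  by rewrite trmx_delta mul_delta_mx [LHS]mx11_scalar mxE eqxx.
have vv : v^T *m v = 1%:M.
  by rewrite [LHS]mx11_scalar -trace_mx11 -/(fnorm2 v) v1.
have ve' : v^T *m e = (v 0 0)%:M.
  by rewrite -colE [LHS]mx11_scalar !mxE.
have ev : e^T *m v = (v 0 0)%:M.
  by rewrite -[LHS]trmxK trmx_mul trmxK ve' tr_scalar_mx.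
have uT : u^T = v^T - e^T by rewrite /u linearB.
have fE : fnorm2 u = 2 - 2 * v 0 0.
  rewrite /fnorm2 uT mulmxBl !mulmxBr vv e1 ve' ev !raddfB /=.
  by rewrite !mxtrace_scalar; ring.
pose H := 1%:M - (2 / fnorm2 u) *: (u *m u^T).
have Ht : H^T = H.
  by rewrite /H linearB linearZ /= trmx_mul trmxK trmx1.
exists H.
  have NN : u *m u^T *m (u *m u^T) = fnorm2 u *: (u *m u^T).
    by rewrite mulmxA -(mulmxA u u^T u) uu mul_mx_scalar scalemxAl.
  rewrite /orthogmx Ht /H mulmxBl mul1mx mulmxBr mulmx1.
  rewrite -scalemxAl -scalemxAr NN !scalerA.
  rewrite [X in - (_ - X *: _)](_ : _ = 2 / fnorm2 u + 2 / fnorm2 u).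
    by rewrite scalerDl opprB addrK subrK.
  by field.
rewrite -/e /H mulmxBl mul1mx -scalemxAl -mulmxA.
have -> : u^T *m e = (v 0 0 - 1)%:M.
  by rewrite uT mulmxBl ve' e1 raddfB.
rewrite mul_mx_scalar scalerA.
rewrite [X in X *: _](_ : _ = - 1); last first.
  by rewrite fE; move: f0; rewrite fE => f0; field.
by rewrite scaleN1r opprK /u addrC subrK.
Qed.

(** An orthogonal change of basis which moves an eigenvector to the first basis
    vector splits off a block of size one. *)
Theorem symmetric_spectral n (S : 'M[R]_n) : S^T = S ->
  exists U : 'M[R]_n, exists2 d : 'rV[R]_n,
    orthogmx U & S = U *m diag_mx d *m U^T.
Proof.
elim: n S => [|n IH] S St.
  by exists 1%:M, 0; [rewrite /orthogmx trmx1 mul1mx | apply/matrixP => -[]].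
have [v [l [v1 Sv]]] := symmetric_eigenvector St.
have [U oU Ue] := orthogmx_first_col v1.
pose T := (U^T *m S *m U : 'M[R]_(1 + n)).
have Tt : T^T = T by rewrite /T !trmx_mul trmxK St mulmxA.
have Te : T *m delta_mx 0 0 = l *: delta_mx 0 0 :> 'cV[R]_(1 + n).
  rewrite /T -(mulmxA (U^T *m S)) Ue -mulmxA Sv -scalemxAr -Ue mulmxA oU.
  by rewrite mul1mx.
have ST : S = U *m T *m U^T.
  by rewrite /T -!mulmxA orthogmxC // mulmx1 mulmxA orthogmxC // mul1mx.
clearbody T.
have T1 i : T i 0 = l * (i == 0)%:R.
  move/matrixP: Te => /(_ i 0); rewrite -colE !mxE => ->.
  by rewrite eqxx andbT.
have l0 : lshift n 0 = 0 :> 'I_(1 + n) by exact/val_inj.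
have TE : T = block_mx l%:M 0 0 (drsubmx T).
  rewrite -[LHS]submxK; congr block_mx; apply/matrixP => i j; rewrite !mxE.
  - by rewrite !ord1 l0 T1 eqxx mulr1.
  - by rewrite -Tt mxE !ord1 l0 T1 mulr0.
  - by rewrite !ord1 l0 T1 mulr0.
have [|P [d oP PE]] := IH (drsubmx T).
  by rewrite trmx_drsub Tt.
pose Q : 'M[R]_(1 + n) := block_mx 1%:M 0 0 P.
have oQ : orthogmx Q.
  rewrite /orthogmx /Q tr_block_mx !trmx0 trmx1 mulmx_block !mulmx0 !mul0mx.
  rewrite !addr0 !add0r mulmx1 oP. by rewrite -scalar_mx_block.
have dE : diag_mx (row_mx l%:M d) =
    block_mx l%:M 0 0 (diag_mx d) :> 'M[R]_(1 + n).
  rewrite diag_mx_row; congr block_mx.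
  by apply/matrixP => i j; rewrite !mxE !ord1.
have TQ : T = Q *m diag_mx (row_mx l%:M d) *m Q^T.
  rewrite dE /Q tr_block_mx !trmx0 trmx1 !mulmx_block !mulmx0 !mul0mx.
  by rewrite !addr0 !add0r !mul0mx mulmx1 mul1mx -PE -TE.
exists (U *m Q), (row_mx l%:M d); first exact: orthogmxM.
by rewrite ST TQ trmx_mul !mulmxA.
Qed.

End SpectralTheorem.

(** * Real powers of positive definite matrices *)

Section SpectralPowers.
Context (R : realType).

(** The exponential of [t] times the symmetric matrix with eigenvalues [a] in
    the orthonormal basis given by the columns of [U]. *)
Definition spow p (U : 'M[R]_p) (a : 'rV[R]_p) (t : R) : 'M[R]_p :=
  U *m diag_mx (\row_j expR (t * a 0 j)) *m U^T.

Context (p : nat) (U : 'M[R]_p) (a : 'rV[R]_p) (oU : orthogmx U).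

Lemma spow_sym t : (spow U a t)^T = spow U a t.
Proof. by rewrite /spow !trmx_mul trmxK tr_diag_mx mulmxA. Qed.

Lemma spowD s t : spow U a (s + t) = spow U a s *m spow U a t.
Proof.
rewrite /spow -!mulmxA (mulmxA U^T) oU mul1mx; congr (_ *m _).
rewrite !mulmxA; congr (_ *m _); rewrite mulmx_diag; congr diag_mx.
by apply/rowP => j; rewrite !mxE mulrDl expRD.
Qed.

Lemma spow0 : spow U a 0 = 1%:M.
Proof.
rewrite /spow (_ : diag_mx _ = 1%:M) ?mulmx1 ?orthogmxC //.
rewrite -diag_const_mx; congr diag_mx.
by apply/rowP => j; rewrite !mxE mul0r expR0.
Qed.

Lemma spowN t : spow U a (- t) *m spow U a t = 1%:M.
Proof. by rewrite -spowD addNr spow0. Qed.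

Lemma spow_double t : (spow U a t)^T *m spow U a t = spow U a (2 * t).
Proof. by rewrite spow_sym -spowD mulr_natl mulr2n. Qed.

Lemma det_spow t : \det (spow U a t) = expR (t * \sum_j a 0 j).
Proof.
rewrite /spow !det_mulmx mulrAC -det_mulmx orthogmxC // det1 mul1r det_diag.
by rewrite mulr_sumr expR_sum; apply: eq_bigr => j _; rewrite mxE.
Qed.

Lemma spow_inj : a != 0 -> injective (spow U a).
Proof.
move=> /eqP a0 s t st.
have [j aj] : exists j, a 0 j != 0.
  apply/existsP; apply: contra_notT a0; rewrite negb_exists => /forallP az.
  by apply/rowP => j; rewrite mxE; apply/eqP; have := az j; rewrite negbK.
have : diag_mx (\row_j expR (s * a 0 j)) = diag_mx (\row_j expR (t * a 0 j)).
  have := congr1 (fun A => U^T *m A *m U) st.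
  by rewrite /spow !mulmxA oU !mul1mx -!mulmxA oU !mulmx1.
move/matrixP => /(_ j j); rewrite !mxE eqxx !mulr1n => /expR_inj.
by move/(mulIf aj).
Qed.

Lemma tr_spow t : \tr (spow U a t) = \sum_j expR (t * a 0 j).
Proof.
rewrite /spow mxtrace_mulC mulmxA oU mul1mx mxtrace_diag.
by apply: eq_bigr => j _; rewrite mxE.
Qed.

Lemma fnorm2_spow n t (w : 'M[R]_(p, n)) :
  fnorm2 (spow U a t *m w) =
  \sum_j expR (2 * t * a 0 j) * fnorm2 (row j (U^T *m w)).
Proof.
rewrite /spow -mulmxA -mulmxA fnorm2_orthl // fnorm2E exchange_big /=.
apply: eq_bigr => j _; rewrite fnorm2E mulr_sumr; apply: eq_bigr => k _.
rewrite big_ord1 mul_diag_mx !mxE exprMn -expRM_natl; congr (expR _ * _).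
by rewrite mulrA.
Qed.

(** A convex function of [t] which takes its minimum both at [0] and at [1] is
    constant in between, and here strictly convex unless [w] is fixed. *)
Lemma spow_fix_of_min n (w : 'M[R]_(p, n)) :
  (forall t, fnorm2 w <= fnorm2 (spow U a t *m w)) ->
  fnorm2 (spow U a 1 *m w) = fnorm2 w ->
  forall t, spow U a t *m w = w.
Proof.
move=> wmin w1 t.
pose c j := fnorm2 (row j (U^T *m w)).
have c0 j : 0 <= c j by exact: fnorm2_ge0.
have w0E : fnorm2 w = \sum_j c j.
  rewrite -[w in LHS]mul1mx -spow0 fnorm2_spow.
  by apply: eq_bigr => j _; rewrite mulr0 mul0r expR0 mul1r.
have : \sum_j (expR (a 0 j) - 1) ^+ 2 * c j <= 0.
  have -> : \sum_j (expR (a 0 j) - 1) ^+ 2 * c j =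
      fnorm2 (spow U a 1 *m w) + fnorm2 w - 2 * fnorm2 (spow U a (2^-1) *m w).
    rewrite !fnorm2_spow w0E mulr_sumr -big_split -sumrB /=.
    apply: eq_bigr => j _.
    rewrite mulr1 divff // mul1r expRM_natl -/(c j); ring.
  by rewrite w1; have := wmin 2^-1; lra.
move=> le0.
have fixj j : a 0 j = 0 \/ row j (U^T *m w) = 0.
  have : (expR (a 0 j) - 1) ^+ 2 * c j == 0.
    pose F j := (expR (a 0 j) - 1) ^+ 2 * c j.
    apply/eqP; apply/(psumr_eq0P (P := predT) (F := F)) => //.
      by move=> i _; rewrite mulr_ge0 // sqr_ge0.
    apply/eqP; rewrite eq_le le0 /=; apply: sumr_ge0 => i _.
    by rewrite mulr_ge0 // sqr_ge0.
  rewrite mulf_eq0 sqrf_eq0 subr_eq0 fnorm2_eq0 => /orP[/eqP|/eqP];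
    last by right.
  by rewrite -[X in _ = X]expR0 => /expR_inj; left.
rewrite /spow -!mulmxA.
have -> : diag_mx (\row_j expR (t * a 0 j)) *m (U^T *m w) = U^T *m w.
  apply/matrixP => j k; rewrite mul_diag_mx !mxE.
  have [->|/rowP/(_ k)] := fixj j; first by rewrite mulr0 expR0 mul1r.
  by rewrite !mxE => ->; rewrite mulr0.
by rewrite mulmxA orthogmxC // mul1mx.
Qed.

(** Chord inequality for the convex function [t |-> fnorm2 (spow U a t *m w)]
    on the interval from [0] to [r]. *)
Lemma fnorm2_spow_chord n (w : 'M[R]_(p, n)) r : 1 <= r ->
  r * (fnorm2 (spow U a 1 *m w) - fnorm2 w) <=
  fnorm2 (spow U a r *m w) - fnorm2 w.
Proof.
move=> r1.
have -> : fnorm2 w = fnorm2 (spow U a 0 *m w) by rewrite spow0 mul1mx.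
rewrite !fnorm2_spow -!sumrB mulr_sumr.
apply: ler_sum => j _; rewrite -!mulrBl mulrA ler_wpM2r ?fnorm2_ge0 //.
rewrite mulr0 mul0r expR0 mulr1; set x := 2 * a 0 j.
have -> : 2 * r * a 0 j = (r - 1) * x + x by rewrite /x; ring.
(* Bernoulli's inequality for [expR x] and the real exponent [r]. *)
have e1 := expR_ge1Dx ((r - 1) * x).
have e2 := expR_ge1Dx (- x).
have ex := expR_gt0 x.
have exN : expR x * expR (- x) = 1 by rewrite -expRD subrr expR0.
rewrite expRD.
have : 0 <= expR x * (expR ((r - 1) * x) - r + (r - 1) * expR (- x)).
  rewrite pmulr_rge0 //.
  have : 0 <= (r - 1) * (expR (- x) - (1 - x)) by rewrite mulr_ge0; lra.
  lra.
have -> : expR x * (expR ((r - 1) * x) - r + (r - 1) * expR (- x)) =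
    expR ((r - 1) * x) * expR x - r * expR x + (r - 1) * (expR x * expR (- x)).
  by ring.
rewrite exN; lra.
Qed.

End SpectralPowers.

Section Polar.
Context (R : realType) (p : nat).

(** A positive definite matrix has positive eigenvalues, which are exponentials;
    the time [2] makes [spow U a 1] the positive part in the polar decomposition
    of [g]. *)
Lemma gram_spow (g : 'M[R]_p) : g \in unitmx ->
  exists U : 'M[R]_p, exists2 a, orthogmx U & g^T *m g = spow U a 2.
Proof.
move=> gu.
have [|U [d oU gE]] := @symmetric_spectral R p (g^T *m g).
  by rewrite trmx_mul trmxK.
have dE : diag_mx d = (g *m U)^T *m (g *m U).
  rewrite trmx_mul -mulmxA (mulmxA g^T) gE -!mulmxA oU mulmx1 mulmxA oU.
  by rewrite mul1mx.
have d0 j : 0 < d 0 j.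
  rewrite lt_neqAle; apply/andP; split; last first.
    have -> : d 0 j = diag_mx d j j by rewrite mxE eqxx mulr1n.
    rewrite dE mxE; apply: sumr_ge0 => i _; rewrite [_^T _ _]mxE -expr2.
    exact: sqr_ge0.
  have : \det (diag_mx d) != 0.
    rewrite dE det_mulmx det_tr mulf_neq0 // -unitfE -unitmxE unitmx_mul gu /=;
    by have /mulmx1_unit[] := oU.
  by rewrite det_diag => /prodf_neq0/(_ j isT); rewrite eq_sym.
exists U, (\row_j (ln (d 0 j) / 2)) => //; rewrite gE /spow.
congr (_ *m diag_mx _ *m _); apply/rowP => j.
by rewrite !mxE mulrC divfK // lnK // posrE.
Qed.

End Polar.

(** * One-parameter groups in Zariski closed groups *)

Section ExponentialPolynomials.
Context (R : realType).

Lemma poly_interpolation (F : fieldType) (s : seq F) (y : F -> F) :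
  exists q : {poly F}, forall x, x \in s -> q.[x] = y x.
Proof.
elim: s => [|x s [q qy]]; first by exists 0.
have [xs|xs] := boolP (x \in s).
  by exists q => z; rewrite inE => /predU1P[->|]; apply: qy.
pose m := \prod_(z <- s) ('X - z%:P).
have mx : m.[x] != 0 by rewrite -[_ == 0]/(root m x) root_prod_XsubC.
exists (q + ((y x - q.[x]) / m.[x]) *: m) => z.
rewrite !hornerE inE => /predU1P[->|zs]; first by field.
have /eqP -> : root m z by rewrite root_prod_XsubC.
by rewrite mulr0 addr0 qy.
Qed.

Definition exppoly (f : R -> R) :=
  exists s : seq (R * R), forall t, f t = \sum_(k <- s) k.1 * expR (t * k.2).

Lemma exppoly_exp c l : exppoly (fun t => c * expR (t * l)).
Proof. by exists [:: (c, l)] => t; rewrite big_seq1. Qed.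

Lemma exppoly_cst c : exppoly (fun=> c).
Proof. by exists [:: (c, 0)] => t; rewrite big_seq1 mulr0 expR0 mulr1. Qed.

Lemma exppolyD f g : exppoly f -> exppoly g -> exppoly (fun t => f t + g t).
Proof.
by move=> [s fs] [r gr]; exists (s ++ r) => t; rewrite big_cat fs gr.
Qed.

Lemma exppolyM f g : exppoly f -> exppoly g -> exppoly (fun t => f t * g t).
Proof.
move=> [s fs] [r gr].
exists [seq (k.1 * l.1, k.2 + l.2) | k <- s, l <- r] => t.
rewrite fs gr big_distrlr /= big_allpairs_dep /=.
apply: eq_bigr => k _; apply: eq_bigr => l _.
by rewrite mulrDr expRD mulrACA.
Qed.

Lemma exppoly_sum (I : Type) (r : seq I) (f : I -> R -> R) :
  (forall i, exppoly (f i)) -> exppoly (fun t => \sum_(i <- r) f i t).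
Proof.
move=> fE; elim: r => [|i r IH].
  by under eq_fun do rewrite big_nil; exact: exppoly_cst.
by under eq_fun do rewrite big_cons; exact: exppolyD.
Qed.

Lemma exppoly_prod (I : Type) (r : seq I) (f : I -> R -> R) :
  (forall i, exppoly (f i)) -> exppoly (fun t => \prod_(i <- r) f i t).
Proof.
move=> fE; elim: r => [|i r IH].
  by under eq_fun do rewrite big_nil; exact: exppoly_cst.
by under eq_fun do rewrite big_cons; exact: exppolyM.
Qed.

Lemma exppolyX f n : exppoly f -> exppoly (fun t => f t ^+ n).
Proof.
move=> fE; elim: n => [|n IH].
  by under eq_fun do rewrite expr0; exact: exppoly_cst.
by under eq_fun do rewrite exprS; exact: exppolyM.
Qed.

(** With [mu = expR (2 * l)], the values at the even integers are the sums of
    the [c * mu ^+ n]. When these vanish, so does the sum of the [c * q.[mu]] for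
    every polynomial [q], in particular for one with [q.[mu] = expR (t * l)] at
    the finitely many [mu] that occur. *)
Lemma exppoly_eq0 f : exppoly f -> (forall n : nat, f (2 * n%:R) = 0) ->
  forall t, f t = 0.
Proof.
move=> [s fs] f0 t.
have [q qE] := poly_interpolation [seq expR (2 * k.2) | k <- s]
  (fun x => expR (t * (ln x / 2))).
have -> : f t = \sum_(k <- s) k.1 * q.[expR (2 * k.2)].
  rewrite fs big_seq [RHS]big_seq; apply: eq_bigr => k ks.
  rewrite qE; last by apply/mapP; exists k.
  by rewrite expRK; congr (_ * expR _); field.
under eq_bigr do rewrite horner_coef mulr_sumr.
rewrite exchange_big big1 //= => i _.
under eq_bigr do rewrite mulrCA -expRM_natl.
rewrite -mulr_sumr (_ : \sum_(k <- s) _ = 0) ?mulr0 //.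
transitivity (f (2 * i%:R)); last exact: f0.
rewrite fs; apply: eq_bigr => k _; congr (_ * expR _).
by rewrite mulrCA mulrA.
Qed.

End ExponentialPolynomials.

Section ZariskiClosedGroups.
Context (R : realType) (p : nat).

Lemma cvg_poly_eval T (F : set_system T) {FF : Filter F}
    (f : mpoly.mpoly (p * p) R) (g : T -> 'M[R]_p) (A : 'M[R]_p) :
  g x @[x --> F] --> A -> poly_eval f (g x) @[x --> F] --> poly_eval f A.
Proof.
move=> gA; rewrite /poly_eval mpoly.mevalE.
under eq_cvg do rewrite mpoly.mevalE.
apply: cvg_sumr => m _; apply: cvgM; first exact: cvg_cst.
apply: cvg_prodr => k _.
elim: (mpoly.fun_of_multinom m k) => [|n IH].
  by rewrite expr0; under eq_cvg do rewrite expr0; exact: cvg_cst.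
rewrite exprS; under eq_cvg do rewrite exprS.
apply: cvgM => //; case: (mxvec_indexP k) => i j; rewrite mxvecE.
by under eq_cvg do rewrite mxvecE; exact: cvg_entry.
Qed.

Lemma exppoly_poly_eval (f : mpoly.mpoly (p * p) R) (g : R -> 'M[R]_p) :
  (forall i j, exppoly (fun t => g t i j)) ->
  exppoly (fun t => poly_eval f (g t)).
Proof.
move=> gE; rewrite /poly_eval; under eq_fun do rewrite mpoly.mevalE.
apply: exppoly_sum => m; apply: exppolyM; first exact: exppoly_cst.
apply: exppoly_prod => k; apply: exppolyX.
by case/mxvec_indexP: k => i j; under eq_fun do rewrite mxvecE.
Qed.

Lemma exppoly_spow (U : 'M[R]_p) (a : 'rV[R]_p) i j :
  exppoly (fun t => spow U a t i j).
Proof.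
have -> : (fun t => spow U a t i j) =
    (fun t => \sum_k U i k * U j k * expR (t * a 0 k)).
  apply/funext => t; rewrite /spow mxE; apply: eq_bigr => k _.
  by rewrite mul_mx_diag !mxE mulrAC.
by apply: exppoly_sum => k; exact: exppoly_exp.
Qed.

Context (G : set 'M[R]_p) (Ggrp : is_subgroup_GL G) (Gcl : zariski_closed G).

(** The equations of [G] restrict to exponential polynomials on the
    one-parameter group [t |-> spow U a t], and vanish at the even integers. *)
Lemma zariski_spow (U : 'M[R]_p) (a : 'rV[R]_p) t :
  orthogmx U -> G (spow U a 2) -> G (spow U a t).
Proof.
move=> oU G2; have [_ G1 GM _] := Ggrp.
have G2n n : G (spow U a (2 * n%:R)).
  elim: n => [|n IH]; first by rewrite mulr0 spow0.
  by rewrite -(natr1 n) mulrDr mulr1 spowD //; exact: GM.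
case: Gcl => F GE; rewrite GE; split.
  by rewrite /= unitmxE det_spow // unitfE gt_eqF // expR_gt0.
move=> f Ff; move: t; apply: exppoly_eq0.
  by apply: exppoly_poly_eval => i j; exact: exppoly_spow.
by move=> n; move: (G2n n); rewrite GE => -[_]; apply.
Qed.

Lemma closed_SL_plus : closed (SL_plus G).
Proof.
case: Gcl => F GE.
have -> : SL_plus G = [set A | \det A = 1] `&`
    \bigcap_(f in F) [set A | poly_eval f A = 0].
  apply/seteqP; split => A.
    by move=> [GA dA]; split => // f Ff; move: GA; rewrite GE => -[_]; apply.
  move=> [dA fA]; split => //; rewrite GE; split => //.
  by rewrite /= unitmxE dA unitr1.
apply: closedI.
  apply: (@closed_comp _ _ (fun A : 'M[R]_p => \det A) [set x : R | x = 1]);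
    last exact: closed_eq.
  by move=> A _; apply: (@cvg_det _ _ (nbhs A) _ _ id); exact: cvg_id.
apply: closed_bigI => f _.
apply: (@closed_comp _ _ (fun A : 'M[R]_p => poly_eval f A)
  [set x : R | x = 0]);
  last exact: closed_eq.
by move=> A _; apply: (@cvg_poly_eval _ (nbhs A) _ f id); exact: cvg_id.
Qed.

End ZariskiClosedGroups.

(** * The subgroups of determinant one and of determinant one up to sign *)

(** Determinant [-1] has to be allowed because, for even [p], an element of
    negative determinant has no scalar multiple of determinant [1]. *)
Definition SLpm (R : realType) p (G : set 'M[R]_p) : set 'M[R]_p :=
  [set A | G A /\ \det A ^+ 2 = 1].

Section SpecialSubgroup.
Context (R : realType) (p : nat) (G : set 'M[R]_p).
Hypotheses (Ggrp : is_subgroup_GL G).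

Lemma SL_plus1 : SL_plus G 1%:M.
Proof. by case: Ggrp => _ G1 _ _; split; rewrite ?det1. Qed.

Lemma SL_plusM A B : SL_plus G A -> SL_plus G B -> SL_plus G (A *m B).
Proof.
case: Ggrp => _ _ GM _ [GA dA] [GB dB]; split; first exact: GM.
by rewrite det_mulmx dA dB mulr1.
Qed.

Lemma SLpmM A B : SLpm G A -> SLpm G B -> SLpm G (A *m B).
Proof.
case: Ggrp => _ _ GM _ [GA dA] [GB dB]; split; first exact: GM.
by rewrite det_mulmx exprMn dA dB mulr1.
Qed.

Lemma SLpmV A : SLpm G A -> SLpm G (invmx A).
Proof.
case: Ggrp => _ _ _ GV [GA dA]; split; first exact: GV.
by rewrite det_inv exprVn dA invr1.
Qed.

Lemma SLpm_unit A : SLpm G A -> A \in unitmx.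
Proof. by move=> [GA _]; case: Ggrp => + _ _ _; apply. Qed.

Lemma SL_plus_SLpm A : SL_plus G A -> SLpm G A.
Proof. by move=> [GA dA]; split; rewrite ?dA ?expr1n. Qed.

Lemma SLpm_det A : SLpm G A -> SL_plus G A \/ \det A = - 1.
Proof.
move=> [GA /eqP]; rewrite -subr_eq0 subr_sqr_1 mulf_eq0 subr_eq0 addr_eq0.
by case/orP => /eqP dA; [left; split|right].
Qed.

Lemma SL_plusN A B : SLpm G A -> SLpm G B -> \det A = - 1 -> \det B = - 1 ->
  SL_plus G (A *m B).
Proof.
move=> SA SB dA dB; have [GAB _] := SLpmM SA SB; split => //.
by rewrite det_mulmx dA dB mulrNN mulr1.
Qed.

Lemma SL_plus_conj A B : SLpm G A -> SL_plus G B ->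
  SL_plus G (A *m B *m invmx A).
Proof.
move=> SA HB; have SB := SL_plus_SLpm HB; have uA := SLpm_unit SA.
have [GC _] := SLpmM (SLpmM SA SB) (SLpmV SA); split => //.
rewrite !det_mulmx det_inv mulrAC mulfV ?mul1r; first by case: HB.
by rewrite -unitfE -unitmxE.
Qed.

Hypotheses (Gcl : zariski_closed G) (Gadj : self_adjoint G).

(** The exponents [a] sum to zero because [h^T *m h] has determinant [1]. *)
Lemma gram_SLpm h : SLpm G h ->
  exists U : 'M[R]_p, exists a : 'rV[R]_p, [/\ orthogmx U,
    h^T *m h = spow U a 2, \sum_j a 0 j = 0 &
    forall t, SL_plus G (spow U a t)].
Proof.
move=> Sh; have [Gh dh] := Sh; have [_ _ GM _] := Ggrp.
have [U [a oU hE]] := gram_spow (SLpm_unit Sh).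
have a0 : \sum_j a 0 j = 0.
  have : \det (spow U a 2) = 1 by rewrite -hE det_mulmx det_tr -expr2.
  rewrite det_spow // -[RHS]expR0 => /expR_inj /eqP.
  by rewrite mulf_eq0 pnatr_eq0 /= => /eqP.
exists U, a; split => // t; split; last by rewrite det_spow // a0 mulr0 expR0.
by apply: zariski_spow => //; rewrite -hE; apply: GM => //; exact: Gadj.
Qed.

End SpecialSubgroup.

(** * Orbits of minimal vectors are closed *)

Lemma fnorm2_gram (R : realType) m n k (A B : 'M[R]_(m, n))
    (w : 'M[R]_(n, k)) :
  A^T *m A = B^T *m B -> fnorm2 (A *m w) = fnorm2 (B *m w).
Proof.
by move=> AB; rewrite /fnorm2 !trmx_mul !mulmxA -!(mulmxA w^T) AB.
Qed.

(** The entries of a Gram matrix are bounded by its trace. *)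
Lemma tr_gram_mul_le (R : realType) p (h D : 'M[R]_p) :
  \tr (h^T *m h *m D) <= (\sum_i \sum_j `|D j i|) * fnorm2 h.
Proof.
rewrite /mxtrace mulr_suml; apply: ler_sum => i _; rewrite mxE mulr_suml.
apply: ler_sum => j _; rewrite mulrC.
apply: le_trans (ler_norm _) _; rewrite normrM ler_wpM2l //.
rewrite mxE ler_norml; under eq_bigr do rewrite mxE.
have sE l : \sum_k h k l ^+ 2 <= fnorm2 h.
  rewrite fnorm2E [leRHS](bigD1 l) //= lerDl.
  by do 2!apply: sumr_ge0 => ? _; rewrite sqr_ge0.
have [si sj] := (sE i, sE j).
have expand (e : R) : \sum_k (h k i + e * h k j) ^+ 2 =
    \sum_k h k i ^+ 2 + e ^+ 2 * (\sum_k h k j ^+ 2) +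
    2 * e * \sum_k h k i * h k j.
  by rewrite !mulr_sumr -!big_split /=; apply: eq_bigr => k _; ring.
have sq_ge0 (e : R) : 0 <= \sum_k (h k i + e * h k j) ^+ 2.
  by apply: sumr_ge0 => k _; rewrite sqr_ge0.
have := sq_ge0 1; have := sq_ge0 (- 1); rewrite !expand.
by move=> p1 p2; apply/andP; split; lra.
Qed.

Lemma sum_cst_ord (R : pzSemiRingType) n (x : R) : \sum_(j < n) x = n%:R * x.
Proof. by rewrite sumr_const card_ord mulr_natl. Qed.

(** A quantitative obstruction to being shortest. Multiplying [h^T *m h] by
    [spow U b (- 4)] shrinks its largest eigenvalue [expR (2 * r * b 0 k)] at
    least by the factor [1 - kappa] and adds at most [1] to each of the others.
    So the trace decreases when [r] is large, and still does so when
    [spow U b (- 4)] is replaced by a nearby matrix [D]. *)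
Lemma polar_trace_le (R : realType) (p : nat) (h U D : 'M[R]_p)
    (b : 'rV[R]_p) r k
    (kappa := 1 - expR (- 4 / p%:R) : R) :
  orthogmx U -> h^T *m h = spow U b (2 * r) -> 2 <= r ->
  (forall j, b 0 j <= b 0 k) -> p%:R^-1 <= b 0 k ->
  fnorm2 h <= \tr (h^T *m h *m D) ->
  (\sum_i \sum_j `|(D - spow U b (- 4)) j i|) * p%:R <= kappa / 2 ->
  kappa / 2 * expR (2 * r / p%:R) <= p%:R.
Proof.
move=> oU hE r2 kmax bk hD tau_le.
have p0 : 0 < p%:R :> R.
  by rewrite ltr0n (leq_ltn_trans (leq0n _) (ltn_ord k)).
set X := expR (2 * r * b 0 k).
have kappa0 : 0 <= kappa.
  rewrite subr_ge0 -[leRHS]expR0 ler_expR mulNr oppr_le0.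
  by rewrite divr_ge0 // ltW.
have nE : fnorm2 h = \sum_j expR (2 * r * b 0 j).
  by rewrite /fnorm2 hE tr_spow.
have nX : fnorm2 h <= p%:R * X.
  rewrite nE -(sum_cst_ord p X).
  apply: ler_sum => j _; rewrite ler_expR ler_wpM2l //; lra.
have main : fnorm2 h - \tr (h^T *m h *m spow U b (- 4)) <=
    (\sum_i \sum_j `|(D - spow U b (- 4)) j i|) * fnorm2 h.
  apply: le_trans (tr_gram_mul_le _ _); rewrite mulmxBr raddfB /=.
  by rewrite lerB.
have low : kappa * X - p%:R <= fnorm2 h - \tr (h^T *m h *m spow U b (- 4)).
  rewrite hE -spowD // tr_spow // nE -sumrB (bigD1 k) //=.
  rewrite -[p%:R]mulr1 -(sum_cst_ord p) [\sum_(j < p) 1](bigD1 k) //=.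
  rewrite opprD -sumrN addrA.
  have bk4 : - 4 * b 0 k <= - 4 / p%:R by lra.
  have : kappa * X - 1 <= expR (2 * r * b 0 k) - expR ((2 * r - 4) * b 0 k).
    have -> : (2 * r - 4) * b 0 k = 2 * r * b 0 k + - 4 * b 0 k by ring.
    rewrite expRD -/X.
    have : X * expR (- 4 * b 0 k) <= X * expR (- 4 / p%:R).
      by rewrite ler_wpM2l ?expR_ge0 // ler_expR.
    by rewrite /kappa; lra.
  move=> h1; apply: lerD => //.
  apply: ler_sum => j _.
  have [bj|bj] := leP 0 (b 0 j).
    have : expR ((2 * r - 4) * b 0 j) <= expR (2 * r * b 0 j).
      by rewrite ler_expR ler_wpM2r //; lra.
    lra.
  have : expR ((2 * r - 4) * b 0 j) <= 1.
    rewrite -[leRHS]expR0 ler_expR; apply: mulr_ge0_le0; lra.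
  have := expR_gt0 (2 * r * b 0 j); lra.
have up : (\sum_i \sum_j `|(D - spow U b (- 4)) j i|) * fnorm2 h <=
    kappa / 2 * X.
  set tau := \sum_i _ in tau_le *.
  apply: (@le_trans _ _ (tau * (p%:R * X))).
    by rewrite ler_wpM2l //; do 2!apply: sumr_ge0 => ? _.
  by rewrite mulrA ler_wpM2r // expR_ge0.
have : kappa / 2 * X <= p%:R by lra.
apply: le_trans; rewrite ler_wpM2l //; first by lra.
by rewrite ler_expR ler_wpM2l //; lra.
Qed.

Section ClosedOrbit.
Context (R : realType) (p N : nat) (G : set 'M[R]_p) (w : 'M[R]_(p, N)).
Hypotheses (Ggrp : is_subgroup_GL G) (Gcl : zariski_closed G)
  (Gadj : self_adjoint G).
Hypothesis wmin : forall h, SL_plus G h -> fnorm2 w <= fnorm2 (h *m w).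

Local Notation H := (SL_plus G).

(** By convexity: [w] and [Q *m w] have the same minimal norm, and the norm of
    [Q *m w] is that of [spow U a 1 *m w]. *)
Lemma gram_fix_of_min Q : H Q -> fnorm2 (Q *m w) = fnorm2 w ->
  Q^T *m Q *m w = w.
Proof.
move=> HQ Qw.
have [U [a [oU QE _ Ht]]] := gram_SLpm Ggrp Gcl Gadj (SL_plus_SLpm HQ).
rewrite QE; apply: spow_fix_of_min => // [t|]; first exact: wmin.
by rewrite -Qw; apply: fnorm2_gram; rewrite QE spow_double // mulr1.
Qed.

(** Polar coordinates far from the orthogonal group. The exponents are scaled so
    that the largest absolute value among the [b 0 j] is [1]; as they sum to
    zero, the largest [b 0 k] is then at least [1 / p]. *)
Lemma gram_SL_plus_polar h : H h -> p%:R < fnorm2 h ->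
  exists U : 'M[R]_p, exists b : 'rV[R]_p, exists r : R,
  [/\ orthogmx U, h^T *m h = spow U b (2 * r), 0 < r,
      (forall t, H (spow U b t)) &
      (forall j, `|b 0 j| <= 1) /\
      exists2 k, (forall j, b 0 j <= b 0 k) & p%:R^-1 <= b 0 k].
Proof.
move=> Hh hp.
have [U [a [oU hE a0 Ht]]] := gram_SLpm Ggrp Gcl Gadj (SL_plus_SLpm Hh).
have nE : fnorm2 h = \sum_j expR (2 * a 0 j) by rewrite /fnorm2 hE tr_spow.
have [j0 aj0] : exists j, a 0 j != 0.
  apply/existsP; apply: contraTT hp; rewrite negb_exists => /forallP az.
  rewrite nE (eq_bigr (fun=> 1)) ?sumr_const ?card_ord ?ltxx // => j _.
  by have := az j; rewrite negbK => /eqP ->; rewrite mulr0 expR0.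
pose l := [arg max_(j > j0) `|a 0 j|]%O.
have lmax j : `|a 0 j| <= `|a 0 l|.
  by rewrite /l; case: Order.TotalTheory.arg_maxP => // i _; apply.
pose r := `|a 0 l|.
have r0 : 0 < r by apply: lt_le_trans (lmax j0); rewrite normr_gt0.
have rn0 : r != 0 by rewrite gt_eqF.
pose b := r^-1 *: a.
have bt t : spow U b t = spow U a (t / r).
  rewrite /spow; congr (_ *m diag_mx _ *m _); apply/rowP => j.
  by rewrite !mxE mulrA.
have bE j : `|b 0 j| = `|a 0 j| / r.
  by rewrite mxE normrM normfV (ger0_norm (ltW r0)) mulrC.
exists U, b, r; split => //.
- by rewrite bt mulfK.
- by move=> t; rewrite bt.
split; first by move=> j; rewrite bE ler_pdivrMr // mul1r.
pose k := [arg max_(j > j0) b 0 j]%O.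
have kmax j : b 0 j <= b 0 k.
  by rewrite /k; case: Order.TotalTheory.arg_maxP => // i _; apply.
exists k => //.
have sumE : \sum_j (b 0 k - b 0 j) = p%:R * b 0 k.
  rewrite sumrB sumr_const card_ord mulr_natl.
  have -> : \sum_j b 0 j = 0.
    by under eq_bigr do rewrite mxE; rewrite -mulr_sumr a0 mulr0.
  by rewrite subr0.
have p0 : 0 < p%:R :> R.
  by rewrite ltr0n (leq_ltn_trans (leq0n _) (ltn_ord j0)).
have bk0 : 0 <= b 0 k.
  rewrite -(pmulr_rge0 _ p0) -sumE; apply: sumr_ge0 => j _.
  by rewrite subr_ge0.
rewrite -[_^-1]mulr1 ler_pdivrMl //.
have : b 0 k - b 0 l <= p%:R * b 0 k.
  rewrite -sumE (bigD1 l) //= lerDl; apply: sumr_ge0 => j _.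
  by rewrite subr_ge0.
have : `|b 0 l| = 1 by rewrite bE divff.
have p1 : 1 <= p%:R :> R by rewrite ler1n -(ltr0n R).
have := ler_peMl bk0 p1.
have := kmax l.
by case: (ler0P (b 0 l)); lra.
Qed.

Let shortest h := H h /\
  forall s, H s -> s *m w = w -> fnorm2 h <= fnorm2 (h *m s).

(** For an unbounded sequence of shortest [h n], written in polar coordinates,
    let [Q] and [L] be the limits of [spow (U n) (b n) 1] and
    [spow (U n) (b n) (- 1)] along an ultrafilter. The convex function
    [t |-> fnorm2 (spow (U n) (b n) t *m w)] is minimal at [0] and bounded at
    the time [r n], which tends to infinity, so [Q] does not change the norm of [w].
    Hence [Q *m Q], and with it [L *m L], fixes [w]; but for some [n] the matrix
    [h n *m (L *m L)] is shorter than [h n]. *)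
Lemma shortest_bounded c : exists C, forall h, shortest h ->
  fnorm2 (h *m w) <= c -> fnorm2 h <= C.
Proof.
apply: contrapT => /forallNP unb.
pose P (n : nat) (x : 'M[R]_p * 'M[R]_p * 'rV[R]_p * R) :=
  let: (h, U, b, r) := x in
  [/\ shortest h, fnorm2 (h *m w) <= c, n%:R < fnorm2 h, orthogmx U &
   [/\ h^T *m h = spow U b (2 * r), 0 < r, (forall t, H (spow U b t)),
    (forall j, `|b 0 j| <= 1) &
    exists2 k, (forall j, b 0 j <= b 0 k) & p%:R^-1 <= b 0 k]].
have /choice[x xP] n : exists x, P n x.
  have /existsNP[h /not_implyP[hs /not_implyP[hc /negP]]] :=
    unb (n + p)%:R.
  rewrite -ltNge natrD => hn.
  have [||U [b [r [oU hE r0 Ht [b1 bk]]]]] := gram_SL_plus_polar (h := h).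
  - by case: hs.
  - by apply: le_lt_trans hn; rewrite lerDr.
  exists (h, U, b, r); split => //.
  by apply: le_lt_trans hn; rewrite lerDl.
pose h n := (x n).1.1.1; pose U n := (x n).1.1.2; pose b n := (x n).1.2.
pose r n := (x n).2.
have {}xP n : [/\ shortest (h n), fnorm2 (h n *m w) <= c, n%:R < fnorm2 (h n),
    orthogmx (U n) &
   [/\ (h n)^T *m h n = spow (U n) (b n) (2 * r n), 0 < r n,
    (forall t, H (spow (U n) (b n) t)),
    (forall j, `|b n 0 j| <= 1) &
    exists2 k, (forall j, b n 0 j <= b n 0 k) & p%:R^-1 <= b n 0 k]].
  by have := xP n; rewrite /h /U /b /r; case: (x n) => [[[]]].
have [F [FU Foo]] := @ultraFilterLemma nat \oo _.
have FP := @ultra_proper _ _ FU.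
have rbig B : F [set n | B <= r n].
  apply: Foo; exists (Num.trunc (p%:R * expR (2 * B))).+1 => // n /= Bn.
  have [_ _ nh oU [hE r0 _ b1 _]] := xP n.
  have : fnorm2 (h n) <= p%:R * expR (2 * r n).
    rewrite /fnorm2 hE tr_spow // -(sum_cst_ord p).
    apply: ler_sum => j _; rewrite ler_expR ler_piMr //; first by lra.
    by have := b1 j; rewrite ler_norml => /andP[].
  move=> /(lt_le_trans nh).
  have : p%:R * expR (2 * B) < n%:R.
    apply: lt_le_trans (Num.Theory.truncnS_gt _) _; by rewrite ler_nat.
  move=> /lt_trans/[apply].
  have p0 : 0 <= p%:R :> R by [].
  move=> lt; have : expR (2 * B) < expR (2 * r n).
    by rewrite ltNge; apply/negP => /(ler_wpM2l p0); rewrite leNgt lt.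
  by rewrite ltr_expR; lra.
have sp_bnd e : (`|e| <= 1) ->
    forall n, fnorm2 (spow (U n) (b n) e) <= p%:R * expR 2.
  move=> e1 n; have [_ _ _ oU [_ _ _ b1 _]] := xP n.
  rewrite /fnorm2 spow_double // tr_spow // -(sum_cst_ord p).
  apply: ler_sum => j _; rewrite ler_expR -mulrA ler_piMr //.
  apply: le_trans (ler_norm _) _; rewrite normrM mulr_ile1 //.
have [Q Qlim] : exists Q : 'M[R]_p, spow (U n) (b n) 1 @[n --> F] --> Q.
  apply: (ultra_bounded_cvg (c := p%:R * expR 2)) => //.
  by apply: filterE => n; apply: sp_bnd; rewrite normr1.
have [L Llim] : exists L : 'M[R]_p, spow (U n) (b n) (- 1) @[n --> F] --> L.
  apply: (ultra_bounded_cvg (c := p%:R * expR 2)) => //.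
  by apply: filterE => n; apply: sp_bnd; rewrite normrN normr1.
have HQ : H Q.
  apply: (closed_cvg _ (closed_SL_plus Gcl) _ Q Qlim).
  by apply: filterE => n; have [_ _ _ _ [_ _ + _ _]] := xP n; apply.
have HL : H L.
  apply: (closed_cvg _ (closed_SL_plus Gcl) _ L Llim).
  by apply: filterE => n; have [_ _ _ _ [_ _ + _ _]] := xP n; apply.
have LQ : L *m Q = 1%:M.
  apply: (@cvg_unique _ (@norm_hausdorff _ _)
    (spow (U n) (b n) (- 1) *m spow (U n) (b n) 1 @[n --> F])).
    exact: cvg_mulmx.
  have -> : (fun n => spow (U n) (b n) (- 1) *m spow (U n) (b n) 1) =
      fun=> 1%:M.
    by apply/funext => n; have [_ _ _ oU _] := xP n; rewrite spowN.
  exact: cvg_cst.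
have Qt : Q^T = Q.
  apply: (@cvg_unique _ (@norm_hausdorff _ _)
    ((spow (U n) (b n) 1)^T @[n --> F])).
    exact: cvg_trmx.
  have -> : (fun n => (spow (U n) (b n) 1)^T) = (fun n => spow (U n) (b n) 1).
    by apply/funext => n; rewrite spow_sym.
  by [].
have Lt : L^T = L.
  apply: (@cvg_unique _ (@norm_hausdorff _ _)
    ((spow (U n) (b n) (- 1))^T @[n --> F])).
    exact: cvg_trmx.
  have -> : (fun n => (spow (U n) (b n) (- 1))^T) =
      (fun n => spow (U n) (b n) (- 1)).
    by apply/funext => n; rewrite spow_sym.
  by [].
have Qw : fnorm2 (Q *m w) = fnorm2 w.
  apply/eqP; rewrite eq_le wmin // andbT; apply/ler_addgt0Pr => e e0.
  have Qwlim : fnorm2 (spow (U n) (b n) 1 *m w) @[n --> F] --> fnorm2 (Q *m w).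
    by apply: cvg_fnorm2; apply: cvg_mulmx => //; exact: cvg_cst.
  apply: (closed_cvg [set y | y <= fnorm2 w + e] _ _ _ Qwlim).
    exact: closed_le.
  apply: filterS (rbig (Num.max 1 (c / e))) => n /=.
  rewrite ge_max => /andP[r1 rc].
  have [_ hc _ oU [hE r0 _ _ _]] := xP n.
  have := fnorm2_spow_chord (b n) oU w r1.
  have -> : fnorm2 (spow (U n) (b n) (r n) *m w) = fnorm2 (h n *m w).
    by apply: fnorm2_gram; rewrite spow_double.
  move=> chord; rewrite -lerBlDl -(ler_pM2l r0); apply: le_trans chord _.
  move: rc; rewrite ler_pdivrMr // => rc.
  by have := fnorm2_ge0 w; lra.
have QQw : Q *m Q *m w = w by rewrite -{1}Qt (gram_fix_of_min HQ Qw).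
have LLw : L *m L *m w = w.
  rewrite -{1}QQw !mulmxA -(mulmxA L L Q) LQ mulmx1 LQ mul1mx.
  by [].
(* Being shortest modulo the stabilizer is tested with [s = L *m L], which gives
   [s *m s^T = D]; this is where the exponent [- 4] comes from. *)
pose D := L *m L *m (L *m L).
have hD n : fnorm2 (h n) <= \tr ((h n)^T *m h n *m D).
  have [[_ hs] _ _ _ _] := xP n.
  apply: le_trans (hs _ (SL_plusM Ggrp HL HL) LLw) _.
  have -> : fnorm2 (h n *m (L *m L)) =
      \tr (L *m L *m ((h n)^T *m h n) *m (L *m L)).
    by rewrite /fnorm2 !trmx_mul Lt !mulmxA.
  by rewrite -mulmxA mxtrace_mulC /D !mulmxA lexx.
pose kappa := 1 - expR (- 4 / p%:R) : R.
pose tau n := (\sum_i \sum_j `|(D - spow (U n) (b n) (- 4)) j i|) * p%:R.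
have p0 : 0 < p%:R :> R.
  have [_ _ _ _ [_ _ _ _ [k _ _]]] := xP 0.
  by rewrite ltr0n (leq_ltn_trans (leq0n _) (ltn_ord k)).
have kappa0 : 0 < kappa.
  rewrite subr_gt0 -[ltRHS]expR0 ltr_expR mulNr oppr_lt0 divr_gt0 //.
have taulim : tau n @[n --> F] --> 0.
  have -> : 0 = (\sum_(i < p) \sum_(j < p) (`|(D - D) j i| : R)) * p%:R.
    rewrite big1 ?mul0r // => i _; rewrite big1 // => j _.
    by rewrite subrr mxE normr0.
  apply: cvgM; last exact: cvg_cst.
  do 2!apply: cvg_sumr => ? _; apply: cvg_norm; apply: cvg_entry.
  apply: cvgB; first exact: cvg_cst.
  pose E n := spow (U n) (b n) (- 1).
  have -> : (fun m => spow (U m) (b m) (- 4)) =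
      (fun n => E n *m E n *m (E n *m E n)).
    apply/funext => n; rewrite /E; have [_ _ _ oU _] := xP n.
    rewrite -!spowD //; congr spow; ring.
  by do 2!apply: cvg_mulmx.
have taule : F [set n | tau n <= kappa / 2].
  have : F [set n | `|0 - tau n| < kappa / 2].
    by move/cvgrPdist_lt: taulim; apply; lra.
  apply: filterS => n /=; rewrite sub0r normrN => /ltW; apply: le_trans.
  exact: ler_norm.
have /filter_ex[n [[r2 rn] tn]] : F ([set n | 2 <= r n] `&`
    [set n | p%:R ^+ 2 / kappa <= r n] `&` [set n | tau n <= kappa / 2]).
  by do 2?apply: filterI.
have [_ _ _ oU [hE r0 _ _ [k kmax bk]]] := xP n.
have := polar_trace_le oU hE r2 kmax bk (hD n) tn.
apply/negP; rewrite -ltNge.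
have := expR_ge1Dx (2 * r n / p%:R); rewrite -/kappa => e1.
move: rn; rewrite /= ler_pdivrMr // => rn.
have pi0 : 0 < p%:R^-1 :> R by rewrite invr_gt0.
have e2 : kappa * (r n / p%:R) >= p%:R.
  by rewrite mulrA ler_pdivlMr // -expr2 mulrC.
have : kappa / 2 * (1 + 2 * r n / p%:R) <= kappa / 2 * expR (2 * r n / p%:R).
  by rewrite ler_wpM2l //; lra.
apply: lt_le_trans.
have -> : kappa / 2 * (1 + 2 * r n / p%:R) = kappa / 2 + kappa * (r n / p%:R).
  by field; rewrite gt_eqF.
lra.
Qed.

(** A limit of points [h w], with each [h] shortest, lifts along an ultrafilter
    to a limit of the [h], because these are bounded. *)
Theorem closed_orbit_of_min : closed (orbit_set (@diag_act R p N) H w).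
Proof.
have rep x : exists h : 'M[R]_p, orbit_set (@diag_act R p N) H w x ->
    shortest h /\ h *m w = x.
  have [[g Hg gw]|nx] := pselect (orbit_set (@diag_act R p N) H w x);
    last by exists 0.
  have [||h [Hh hw] hmin] :=
    @closed_fnorm2_min R p p (H `&` [set A | A *m w = x]).
  - apply: closedI; first exact: closed_SL_plus.
    apply: (@closed_comp _ _ (fun A : 'M[R]_p => A *m w) [set y | y = x]).
      move=> A _; apply: (@cvg_mulmx _ _ (nbhs A)); first exact: cvg_id.
      exact: cvg_cst.
    exact/accessible_closed_set1/hausdorff_accessible/norm_hausdorff.
  - by exists g; split.
  exists h => _; split => //; split=> // s Hs sw.
  apply: hmin; split; first exact: SL_plusM.
  by rewrite /= -mulmxA sw.
have [f fE] := choice rep.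
move=> y; rewrite closureEcvg => -[F0 F0P [F0y F0orb]].
have [F [FU F0F]] := @ultraFilterLemma _ F0 F0P.
have FP := @ultra_proper _ _ FU.
have Fy : id x @[x --> F] --> y by move=> A /F0y /F0F.
have Forb : F (orbit_set (@diag_act R p N) H w).
  by apply: F0F; apply: F0orb.
have [C Cbnd] := shortest_bounded (fnorm2 y + 1).
have Fbnd : F [set x | fnorm2 (f x) <= C].
  have : F [set x | fnorm2 x < fnorm2 y + 1].
    have fy : fnorm2 x @[x --> F] --> fnorm2 y.
      by apply: (@cvg_fnorm2 R _ F _ _ _ id).
    by apply: (@cvgr_lt _ _ F _ _ _ fy); lra.
  apply: filterS2 Forb => x ox xy /=; have [fs fw] := fE _ ox.
  by apply: Cbnd; rewrite ?fw ?ltW.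
have [g glim] := ultra_bounded_cvg FU Fbnd.
have Hg : H g.
  apply: (closed_cvg _ (closed_SL_plus Gcl) _ g glim).
  by apply: filterS Forb => x ox; have [[]] := fE _ ox.
exists g => //; rewrite /diag_act.
apply: (@cvg_unique _ (@norm_hausdorff _ _) (f x *m w @[x --> F])).
  by apply: cvg_mulmx => //; exact: cvg_cst.
apply: cvg_trans Fy; apply: near_eq_cvg.
by apply: filterS Forb => x ox; have [] := fE _ ox.
Qed.

End ClosedOrbit.

Lemma gramZ (R : comPzRingType) m n (c : R) (A : 'M[R]_(m, n)) :
  (c *: A)^T *m (c *: A) = c ^+ 2 *: (A^T *m A).
Proof.
have -> : (c *: A)^T = c *: A^T by rewrite linearZ.
by rewrite -scalemxAl -scalemxAr scalerA.
Qed.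

(** * The log-likelihood *)

Definition minimizer (R : realType) p N (G : set 'M[R]_p)
    (v : 'M[R]_(p, N)) h :=
  SLpm G h /\ forall h', SLpm G h' -> fnorm2 (h *m v) <= fnorm2 (h' *m v).

Section LogLikelihood.
Context (R : realType) (p N : nat) (Y : 'I_N -> 'cV[R]_p) (W : 'I_N -> R).
Hypotheses (hp : (1 <= p)%N) (hN : (1 <= N)%N) (hW : forall i, 0 < W i).

Local Notation v := (scaled_sample Y W).
Local Notation kappa := ((N * p)%:R : R).

Let kappa_gt0 : 0 < kappa.
Proof. by rewrite ltr0n muln_gt0 hN. Qed.

Lemma loglik_gram A :
  loglik Y W (A^T *m A) = N%:R * ln (\det A ^+ 2) - fnorm2 (A *m v).
Proof.
rewrite /loglik det_mulmx det_tr -expr2; congr (_ - _).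
rewrite fnorm2E; apply: eq_bigr => i _.
have -> : \tr (A^T *m A *m (Y i *m (Y i)^T)) = fnorm2 (A *m Y i).
  by rewrite /fnorm2 trmx_mul mulmxA mxtrace_mulC !mulmxA.
rewrite fnorm2E big_ord1 mulr_sumr; apply: eq_bigr => j _.
have -> : (A *m v) j i = (Num.sqrt (W i))^-1 * (A *m Y i) j 0.
  rewrite !mxE mulr_sumr; apply: eq_bigr => k _; rewrite !mxE; ring.
by rewrite exprMn exprVn sqr_sqrtr // ltW.
Qed.

Lemma loglik_scaled x (h : 'M[R]_p) : 0 < x -> \det h ^+ 2 = 1 ->
  loglik Y W (x *: (h^T *m h)) = kappa * ln x - x * fnorm2 (h *m v).
Proof.
move=> x0 h1; set s := Num.sqrt x.
have s2 : s ^+ 2 = x by rewrite sqr_sqrtr // ltW.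
have -> : x *: (h^T *m h) = (s *: h)^T *m (s *: h).
  by rewrite gramZ s2.
rewrite loglik_gram -scalemxAl fnorm2Z s2; congr (_ - _).
rewrite detZ exprMn h1 mulr1 exprAC s2 lnXn // natrM -mulrA.
by congr (_ * _); rewrite mulr_natl.
Qed.

(** The inequality [ln y <= y - 1] at [y = x * q / k]. *)
Lemma log_sub_linear_le (k q x : R) : 0 < k -> 0 < q -> 0 < x ->
  k * ln x - x * q <= k * ln (k / q) - k.
Proof.
move=> k0 q0 x0; have y0 : 0 < x * q / k by rewrite !(mulr_gt0, invr_gt0).
have := expR_ge1Dx (ln (x * q / k)); rewrite lnK ?posrE // -(ler_pM2l k0).
have -> : k * (x * q / k) = x * q by field; rewrite gt_eqF.
rewrite !lnM ?lnV ?posrE ?mulr_gt0 ?invr_gt0 //; lra.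
Qed.

Lemma log_sub_linear_eq (k q x : R) : 0 < k -> 0 < q -> 0 < x ->
  k * ln (k / q) - k <= k * ln x - x * q -> x = k / q.
Proof.
move=> k0 q0 x0 le; have y0 : 0 < x * q / k by rewrite !(mulr_gt0, invr_gt0).
have [/eqP z0|z0] := boolP (ln (x * q / k) == 0).
  have := lnK y0; rewrite z0 expR0 => y1.
  have -> : x = k / q * (x * q / k) by field; rewrite !gt_eqF.
  by rewrite -y1 mulr1.
have := expR_gt1Dx z0; rewrite lnK ?posrE // -(ltr_pM2l k0).
have -> : k * (x * q / k) = x * q by field; rewrite gt_eqF.
move: le; rewrite !lnM ?lnV ?posrE ?mulr_gt0 ?invr_gt0 //; lra.
Qed.

Context (G : set 'M[R]_p).
Hypotheses (Ggrp : is_subgroup_GL G) (Gscal : closed_under_scaling G).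

(** With [c ^+ p = `|\det A|], the matrix [c^-1 *: A] has determinant [1] or
    [-1]. *)
Lemma laplace_modelP Psi : laplace_model G Psi <->
  exists x h, [/\ 0 < x, SLpm G h & Psi = x *: (h^T *m h)].
Proof.
split=> [[A GA <-]|[x [h [x0 [Gh h1] ->]]]]; last first.
  set s := Num.sqrt x; have s0 : 0 < s by rewrite sqrtr_gt0.
  exists (s *: h); first by apply: Gscal; rewrite // gt_eqF.
  by rewrite gramZ sqr_sqrtr // ltW.
have dA : 0 < `|\det A|.
  by rewrite normr_gt0 -unitfE -unitmxE; case: Ggrp => + _ _ _; apply.
pose c := expR (ln `|\det A| / p%:R).
have c0 : 0 < c by exact: expR_gt0.
have cp : c ^+ p = `|\det A|.
  by rewrite /c -expRM_natl mulrC divfK ?lnK // pnatr_eq0 -lt0n.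
exists (c ^+ 2), (c^-1 *: A); split; first by rewrite exprn_gt0.
  split; first by apply: Gscal; rewrite // invr_eq0 gt_eqF.
  rewrite detZ exprVn cp exprMn exprVn real_normK ?num_real // mulVf //.
  by rewrite sqrf_eq0 -normr_gt0.
rewrite gramZ scalerA.
rewrite [X in X *: _](_ : _ = 1) ?scale1r //; field; by rewrite gt_eqF.
Qed.

(** For fixed [h], the function [kappa * ln x - x * fnorm2 (h *m v)] of [x] has
    the unique maximizer [kappa / fnorm2 (h *m v)]; for fixed [x] it decreases
    with [fnorm2 (h *m v)]. *)
Lemma is_MLEP Psi : is_MLE Y W G Psi <->
  exists h, [/\ minimizer G v h, 0 < fnorm2 (h *m v) &
    Psi = (kappa / fnorm2 (h *m v)) *: (h^T *m h)].
Proof.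
split=> [[/laplace_modelP[x [h [x0 Sh ->]]] Pmax]|[h [[Sh hmin] q0 ->]]];
  last first.
  have k0 : 0 < kappa / fnorm2 (h *m v) by rewrite divr_gt0.
  split; first by apply/laplace_modelP; exists (kappa / fnorm2 (h *m v)), h.
  move=> _ /laplace_modelP[x [h' [x0 Sh' ->]]].
  rewrite !loglik_scaled //; [|by case: Sh|by case: Sh'].
  rewrite divfK ?gt_eqF //; apply: le_trans (log_sub_linear_le _ q0 x0) => //.
  by rewrite lerB // ler_wpM2l ?hmin // ltW.
have {}Pmax x' h' : 0 < x' -> SLpm G h' ->
    kappa * ln x' - x' * fnorm2 (h' *m v) <=
    kappa * ln x - x * fnorm2 (h *m v).
  move=> x'0 Sh'; rewrite -!loglik_scaled //; [|by case: Sh|by case: Sh'].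
  by apply: Pmax; apply/laplace_modelP; exists x', h'.
have q0 : 0 < fnorm2 (h *m v).
  rewrite lt_neqAle fnorm2_ge0 andbT eq_sym; apply/negP => /eqP q0.
  (* If [h *m v = 0], scaling up increases the likelihood. *)
  have := Pmax (expR 1 * x) h (mulr_gt0 (expR_gt0 1) x0) Sh.
  rewrite q0 !mulr0 !subr0 ler_pM2l // lnM ?posrE ?expR_gt0 // expRK; lra.
have xE : x = kappa / fnorm2 (h *m v).
  apply: log_sub_linear_eq => //.
  have := Pmax (kappa / fnorm2 (h *m v)) h (divr_gt0 kappa_gt0 q0) Sh.
  by rewrite divfK // gt_eqF.
exists h; split; [split => // h' Sh'|by []|by rewrite xE].
by have := Pmax x h' x0 Sh'; rewrite lerD2l lerN2 ler_pM2l.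
Qed.

Lemma loglik_boundedP : loglik_bounded Y W G <->
  exists2 m, 0 < m & forall h, SLpm G h -> m <= fnorm2 (h *m v).
Proof.
split=> [[C Cub]|[m m0 mle]].
  (* Here [kappa * ln x = C + 1], so [C] bounds [x * fnorm2 (h *m v)] from below
     by [1]. *)
  pose x := expR ((C + 1) / kappa); have x0 : 0 < x by exact: expR_gt0.
  exists x^-1; first by rewrite invr_gt0.
  move=> h Sh; have : loglik Y W (x *: (h^T *m h)) <= C.
    apply: Cub; exists (x *: (h^T *m h)) => //.
    by apply/laplace_modelP; exists x, h.
  rewrite loglik_scaled //; last by case: Sh.
  rewrite /x expRK mulrC divfK ?gt_eqF // -/x => le.
  by rewrite -[x^-1]mulr1 ler_pdivrMl //; lra.
exists (kappa * ln (kappa / m) - kappa).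
move=> _ [_ /laplace_modelP[x [h [x0 Sh ->]]] <-].
rewrite loglik_scaled //; last by case: Sh.
apply: le_trans (log_sub_linear_le kappa_gt0 m0 x0).
by rewrite lerB // ler_wpM2l ?mle // ltW.
Qed.

End LogLikelihood.

(** * Stability under the two subgroups *)

Section MinimizersAndStability.
Context (R : realType) (p N : nat) (G : set 'M[R]_p) (v : 'M[R]_(p, N)).
Hypotheses (Ggrp : is_subgroup_GL G).

Local Notation H := (SL_plus G).
Local Notation act := (@diag_act R p N).

Lemma unstableP : unstable act H v <->
  forall e, 0 < e -> exists2 h, H h & fnorm2 (h *m v) < e.
Proof.
split=> [cl e e0|small].
  apply: contrapT => no.
  have Ccl : closed [set x : 'M[R]_(p, N) | e <= fnorm2 x].
    apply: (@closed_comp _ _ (@fnorm2 R p N) [set t | e <= t]);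
      last exact: closed_ge.
    by move=> x _; apply: (@cvg_fnorm2 _ _ (nbhs x) _ _ _ id); exact: cvg_id.
  have sub : orbit_set act H v `<=` [set x : 'M[R]_(p, N) | e <= fnorm2 x].
    move=> _ [h Hh <-] /=; rewrite leNgt; apply/negP => lt.
    by apply: no; exists h.
  have := closureS sub cl; rewrite -(closure_id _).1 //=.
  have /eqP -> : fnorm2 (0 : 'M[R]_(p, N)) == 0 by rewrite fnorm2_eq0.
  by rewrite leNgt e0.
move=> B /nbhs_ballP[e /= e0 eB].
have [h Hh hv] := small (e ^+ 2) (exprn_gt0 _ e0).
exists (h *m v); split; first by exists h.
apply: eB; split => // i j; rewrite /ball /= mxE sub0r normrN.
rewrite -(ltr_pXn2r (n := 2)) ?nnegrE // ?ltW // real_normK ?num_real //.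
exact: le_lt_trans (sqr_entry_le_fnorm2 _ _ _) hv.
Qed.

(** Multiplication by a fixed element of determinant [-1] enlarges norms at most
    by a constant factor and corrects the sign of the determinant. *)
Lemma small_SL_plus :
  (forall e, 0 < e -> exists2 h, H h & fnorm2 (h *m v) < e) <->
  (forall e, 0 < e -> exists2 h, SLpm G h & fnorm2 (h *m v) < e).
Proof.
split=> small e e0.
  by have [h Hh he] := small e e0; exists h => //; exact: SL_plus_SLpm.
have [[B [SB dB]]|noB] := pselect (exists B, SLpm G B /\ \det B = - 1);
  last first.
  have [h Sh he] := small e e0; exists h => //.
  by have [//|dh] := SLpm_det Sh; case: noB; exists h.
have C0 : 0 < fnorm2 B + 1 by have := fnorm2_ge0 B; lra.
have e'0 : 0 < Num.min e (e / (fnorm2 B + 1)) by rewrite lt_min e0 divr_gt0.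
have [h Sh] := small _ e'0; rewrite lt_min => /andP[he he'].
have [Hh|dh] := SLpm_det Sh; first by exists h.
exists (B *m h); first exact: SL_plusN.
rewrite -mulmxA; apply: le_lt_trans (fnorm2_mul_le _ _) _.
move: he'; rewrite ltr_pdivlMr // => /(le_lt_trans _); apply.
by rewrite mulrC ler_wpM2l ?fnorm2_ge0 //; lra.
Qed.

(** The larger orbit is a union of at most two translates of the smaller one. *)
Lemma SLpm_orbit_closed : closed (orbit_set act H v) ->
  closed (orbit_set act (SLpm G) v).
Proof.
move=> Hcl.
have [[B [SB dB]]|noB] := pselect (exists B, SLpm G B /\ \det B = - 1);
  last first.
  rewrite (_ : SLpm G = H) //; apply/seteqP; split => A;
    last exact: SL_plus_SLpm.
  by move=> SA; have [//|dA] := SLpm_det SA; case: noB; exists A.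
have uB := SLpm_unit Ggrp SB.
have -> : orbit_set act (SLpm G) v = orbit_set act H v `|`
    [set x | orbit_set act H v (B *m x)].
  apply/seteqP; split => x.
    move=> [h Sh <-]; have [Hh|dh] := SLpm_det Sh; first by left; exists h.
    by right; exists (B *m h); [exact: SL_plusN|rewrite /diag_act mulmxA].
  move=> [[h Hh <-]|[h Hh hx]]; first by exists h => //; exact: SL_plus_SLpm.
  exists (invmx B *m h).
    by apply: (SLpmM Ggrp); [exact: (SLpmV Ggrp)|exact: SL_plus_SLpm].
  by rewrite /diag_act -mulmxA -/(diag_act h v) hx mulKmx.
apply: closedU => //.
apply: (@closed_comp _ _ (fun x : 'M[R]_(p, N) => B *m x)) => // x _.
by apply: (@cvg_mulmx _ _ (nbhs x)); [exact: cvg_cst|exact: cvg_id].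
Qed.

(** The subgroup of determinant [1] is normal, so [h] carries the orbit of [v]
    onto that of [h *m v]. *)
Lemma SL_plus_orbit_closed h : SLpm G h ->
  closed (orbit_set act H (h *m v)) -> closed (orbit_set act H v).
Proof.
move=> Sh hcl; have uh := SLpm_unit Ggrp Sh.
rewrite (_ : orbit_set act H v = [set x | orbit_set act H (h *m v) (h *m x)]).
  apply: (@closed_comp _ _ (fun x : 'M[R]_(p, N) => h *m x)) => // x _.
  by apply: (@cvg_mulmx _ _ (nbhs x)); [exact: cvg_cst|exact: cvg_id].
apply/seteqP; split => x [g Hg gx].
  exists (h *m g *m invmx h); first exact: SL_plus_conj.
  by rewrite /diag_act -!mulmxA mulKmx // -/(diag_act g v) gx.
exists (invmx h *m g *m h).
  by have := SL_plus_conj Ggrp (SLpmV Ggrp Sh) Hg; rewrite invmxK.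
by move: gx; rewrite /diag_act -!mulmxA => ->; rewrite mulKmx.
Qed.

End MinimizersAndStability.

Lemma infinite_range_nat T (f : nat -> T) (A : set T) :
  injective f -> (forall n, A (f n)) -> ~ finite_set A.
Proof.
move=> fi fA Afin; have := @finite_preimage _ _ A f _ Afin.
rewrite (_ : f @^-1` A = setT); last first.
  by apply/seteqP; split => // n _; exact: fA.
by move=> fin; apply: infinite_nat; apply: fin => x y _ _; exact: fi.
Qed.

(** * Stability and maximum likelihood *)

Section MaximumLikelihood.
Context (R : realType) (p N : nat) (Y : 'I_N -> 'cV[R]_p) (W : 'I_N -> R).
Hypotheses (hp : (1 <= p)%N) (hN : (1 <= N)%N) (hW : forall i, 0 < W i).
Context (G : set 'M[R]_p).
Hypotheses (Ggrp : is_subgroup_GL G) (Gcl : zariski_closed G)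
  (Gadj : self_adjoint G) (Gscal : closed_under_scaling G).

Local Notation v := (scaled_sample Y W).
Local Notation H := (SL_plus G).
Local Notation act := (@diag_act R p N).

Lemma unstable_loglik : unstable act H v <-> ~ loglik_bounded Y W G.
Proof.
rewrite unstableP small_SL_plus // loglik_boundedP //.
split=> [small [m m0 mle]|nb e e0].
  by have [h Sh] := small m m0; rewrite ltNge mle.
apply: contrapT => no; apply: nb; exists e => // h Sh.
by rewrite leNgt; apply/negP => lt; apply: no; exists h.
Qed.

Lemma minimizer_SL_plus h : minimizer G v h -> forall g, H g ->
  fnorm2 (h *m v) <= fnorm2 (g *m (h *m v)).
Proof.
move=> [Sh hmin] g Hg; rewrite mulmxA; apply: hmin.
by apply: SLpmM => //; exact: SL_plus_SLpm.
Qed.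

Lemma polystable_MLE : polystable act H v <-> exists Psi, is_MLE Y W G Psi.
Proof.
split=> [[v0 vcl]|[Psi /is_MLEP[//|//|//|//|//|h [hmin q0 _]]]].
  have [|_ [h Sh <-] hmin] := closed_fnorm2_min (SLpm_orbit_closed Ggrp vcl).
    exists v, 1%:M; last by rewrite /diag_act mul1mx.
    by apply: SL_plus_SLpm; exact: SL_plus1.
  have q0 : 0 < fnorm2 (h *m v).
    rewrite fnorm2_gt0; apply/eqP => hv0; apply: v0.
    by rewrite -(mulKmx (SLpm_unit Ggrp Sh) v) hv0 mulmx0.
  eexists; apply/is_MLEP => //; exists h; split=> //; split=> // h' Sh'.
  by apply: hmin; exists h'.
split.
  by move=> v0; move: q0; rewrite v0 mulmx0 fnorm2_gt0 eqxx.
have [Sh _] := hmin.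
apply: (SL_plus_orbit_closed Ggrp Sh).
exact: (closed_orbit_of_min Ggrp Gcl Gadj (minimizer_SL_plus hmin)).
Qed.

(** Two maximizers come from minimal vectors [h *m v] and [g *m (h *m v)]. If the
    maximizers differ, the positive part of [g] is not the identity; it generates
    a one-parameter group along which the norm of [h *m v] is minimal at the
    times [0] and [1], hence constant. *)
Lemma MLE_not_unique Psi1 Psi2 :
  is_MLE Y W G Psi1 -> is_MLE Y W G Psi2 -> Psi1 != Psi2 ->
  exists U : 'M[R]_p, exists a : 'rV[R]_p, exists h : 'M[R]_p,
  [/\ orthogmx U, a != 0, minimizer G v h /\ 0 < fnorm2 (h *m v),
   forall t, H (spow U a t) &
   forall t, spow U a t *m (h *m v) = h *m v].
Proof.
move=> /is_MLEP[//|//|//|//|//|h1 [[S1 min1] q1 ->]].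
move=> /is_MLEP[//|//|//|//|//|h2 [[S2 min2] q2 ->]] ne.
have u1 := SLpm_unit Ggrp S1.
have qq : fnorm2 (h2 *m v) = fnorm2 (h1 *m v).
  by apply/eqP; rewrite eq_le min1 // min2.
pose g := h2 *m invmx h1.
have gh : g *m h1 = h2 by rewrite /g mulmxKV.
have Sg : SLpm G g by apply: SLpmM => //; exact: SLpmV.
have [U [a [oU gE _ Ht]]] := gram_SLpm Ggrp Gcl Gadj Sg.
exists U, a, h1; split => //.
  apply: contraNneq ne => aE; rewrite qq; apply/eqP; congr (_ *: _).
  rewrite -gh trmx_mul mulmxA -(mulmxA h1^T) gE.
  have -> : spow U a 2 = 1%:M; last by rewrite mulmx1.
  rewrite -(spow0 a oU) /spow aE; congr (_ *m diag_mx _ *m _).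
  by apply/rowP => j; rewrite !mxE mulr0 mul0r.
apply: spow_fix_of_min => // [t|]; first exact: minimizer_SL_plus.
rewrite -qq -gh -[g *m h1 *m v]mulmxA; apply: fnorm2_gram.
by rewrite gE spow_double // mulr1.
Qed.

(** The points of the one-parameter group at integer times give infinitely many
    maximizers. *)
Lemma finite_MLE_unique : finite_set (is_MLE Y W G) ->
  forall Psi1 Psi2, is_MLE Y W G Psi1 -> is_MLE Y W G Psi2 -> Psi1 = Psi2.
Proof.
move=> fin Psi1 Psi2 M1 M2; apply: contrapT => /eqP ne; move: fin.
have [U [a [h [oU a0 [[Sh hmin] q0] Ht fix_]]]] := MLE_not_unique M1 M2 ne.
have uh := SLpm_unit Ggrp Sh.
pose k := (N * p)%:R / fnorm2 (h *m v).
have k0 : k != 0 by rewrite mulf_neq0 ?invr_eq0 ?gt_eqF // ltr0n muln_gt0 hN.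
pose f (n : nat) := k *: ((spow U a n%:R *m h)^T *m (spow U a n%:R *m h)).
apply: (@infinite_range_nat _ f).
  have gramE t : (spow U a t *m h)^T *m (spow U a t *m h) =
      h^T *m spow U a (2 * t) *m h.
    by rewrite (trmx_mul _ h) -(spow_double a oU t) !mulmxA.
  move=> m n /(scalerI k0); rewrite !gramE.
  move=> /(congr1 (fun A => A *m invmx h)).
  rewrite !mulmxK // => /(congr1 (fun A => invmx h^T *m A)).
  rewrite !mulKmx ?unitmx_tr // => /(spow_inj oU a0) mn.
  by apply/eqP; rewrite -(eqr_nat R); apply/eqP; lra.
move=> n; apply/is_MLEP => //.
have Sn : SLpm G (spow U a n%:R *m h).
  by apply: SLpmM => //; exact: SL_plus_SLpm.
exists (spow U a n%:R *m h); rewrite -mulmxA fix_.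
split=> //; split=> // h' Sh'.
by rewrite -mulmxA fix_ hmin.
Qed.

(** Conjugated by [h], the one-parameter group fixes [v]. *)
Lemma stable_MLE_unique : stable act H v ->
  forall Psi1 Psi2, is_MLE Y W G Psi1 -> is_MLE Y W G Psi2 -> Psi1 = Psi2.
Proof.
move=> [_ fin] Psi1 Psi2 M1 M2; apply: contrapT => /eqP ne; move: fin.
have [U [a [h [oU a0 [[Sh hmin] q0] Ht fix_]]]] := MLE_not_unique M1 M2 ne.
have uh := SLpm_unit Ggrp Sh.
pose f (n : nat) := invmx h *m spow U a n%:R *m h.
apply: (@infinite_range_nat _ f).
  move=> m n /(congr1 (fun A => h *m A *m invmx h)).
  rewrite /f !mulmxA !mulmxK // !mulmxV // !mul1mx => /(spow_inj oU a0)/eqP.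
  by rewrite eqr_nat => /eqP.
move=> n; split.
  by have := SL_plus_conj Ggrp (SLpmV Ggrp Sh) (Ht n%:R); rewrite invmxK.
by rewrite /diag_act /f -(mulmxA _ h v) -(mulmxA (invmx h)) fix_ mulKmx.
Qed.

End MaximumLikelihood.

Theorem theorem3p8 (R : realType) (p N : nat) (hp : (1 <= p)%N) (hN : (1 <= N)%N)
    (Y : 'I_N -> 'cV[R]_p) (W : 'I_N -> R) (hW : forall i, 0 < W i)
    (G : set 'M[R]_p)
    (hGgroup : is_subgroup_GL G)
    (hGclosed : zariski_closed G)
    (hGadj : self_adjoint G)
    (hGscal : closed_under_scaling G) :
  let YW := scaled_sample Y W in
  let H := SL_plus G in
  let act := @diag_act R p N in
  [/\ unstable act H YW <-> ~ loglik_bounded Y W G,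
      semistable act H YW <-> loglik_bounded Y W G,
      polystable act H YW <-> (exists Psi, is_MLE Y W G Psi) &
      (stable act H YW ->
         is_MLE Y W G !=set0 /\ finite_set (is_MLE Y W G)) /\
      (is_MLE Y W G !=set0 /\ finite_set (is_MLE Y W G) <->
         exists! Psi, is_MLE Y W G Psi)].
Proof.
move=> YW H act.
have unst := unstable_loglik Y hp hN hW hGgroup hGscal.
have poly := polystable_MLE Y hp hN hW hGgroup hGclosed hGadj hGscal.
have uniq_fin Psi : is_MLE Y W G Psi ->
    (forall Psi', is_MLE Y W G Psi' -> Psi = Psi') ->
    is_MLE Y W G !=set0 /\ finite_set (is_MLE Y W G).
  move=> MPsi PsiU; split; first by exists Psi.
  rewrite (_ : is_MLE Y W G = [set Psi]); first exact: finite_set1.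
  by apply/seteqP; split => [Psi' /PsiU|_ ->].
split; [exact: unst| |exact: poly|split].
- rewrite /semistable -/(unstable act H YW) unst.
  by split=> [|b nb]; [exact: contrapT|exact: nb].
- move=> st.
  have [Psi MPsi] : exists Psi, is_MLE Y W G Psi by apply/poly; case: st.
  apply: (uniq_fin Psi) => // Psi' MPsi'.
  exact: (stable_MLE_unique hp hN hW hGgroup hGclosed hGadj hGscal st).
- split=> [[[Psi MPsi] fin]|[Psi [MPsi PsiU]]]; last exact: (uniq_fin Psi).
  exists Psi; split => // Psi' MPsi'.
  exact: (finite_MLE_unique hp hN hW hGgroup hGclosed hGadj hGscal fin).
Qed.
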